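(* There exist two distinct real numbers $a_1,a_2\in(1,\sqrt2)$ (with $a_1\approx 1.3299$ and $a_2\approx 1.4123$) such that, for each $a\in\{a_1,a_2\}$, the side-length function $s_a\colon S^1\to\mathbb{R}$ has at least twenty local minima and at least twenty local maxima.
   Context: For $a>1$ let $E_a=\{(x,y)\in\mathbb{R}^2 : (x/a)^2+y^2=1\}$ with the Euclidean metric $d$, and let $\varphi_a\colon S^1\to E_a$ be the homeomorphism $(\cos\theta,\sin\theta)\mapsto(a\cos\theta,\sin\theta)$, where $S^1$ is the unit circle in $\mathbb{R}^2$. For $p,q\in S^1$, $[p,q]$ denotes the closed clockwise arc from $p$ to $q$, and $\vec d(p,q)\in[0,2\pi)$ denotes its length. For $a\in(1,\sqrt2)$ let $h_a\colon S^1\to S^1$ be the map such that $\varphi_a(h_a(p))$ is the unique point of $E_a$ other than $\varphi_a(p)$ lying on the normal line to $E_a$ at $\varphi_a(p)$; it is known that $h_a$ is a bijection. For $p\in S^1$, $r\in(0,2)$, define $F(p,r,a)$ to be the point $q\in[p,h_a^{-1}(p)]$ maximizing $d(\varphi_a(p),\varphi_a(q))$ subject to $d(\varphi_a(p),\varphi_a(q))\le r$ (i.e. the first point clockwise from $p$ at Euclidean distance $r$ as measured on $E_a$). Put $F^1=F$ and $F^{n+1}(p,r,a)=F(F^n(p,r,a),r,a)$. The side-length function (for 5-pointed stars wrapping twice around $E_a$) is $$s_a(p)=\inf\Big\{r\in(0,2) : \sum_{i=1}^5\vec d\big(F^i(p,r,a),F^{i+1}(p,r,a)\big)\ge 4\pi\Big\}.$$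 *)

(* Defs.v *)
From HB Require Import structures.
From mathcomp Require Import all_boot all_order all_algebra.
From mathcomp Require Import all_classical all_reals all_analysis.

Set Implicit Arguments.
Unset Strict Implicit.
Unset Printing Implicit Defensive.

Import Order.TTheory GRing.Theory Num.Theory.
Import numFieldNormedType.Exports.

Local Open Scope classical_set_scope.
Local Open Scope ring_scope.

(* The plane is [R * R] with its product topology, which is the Euclidean one.
   The norm that the library puts on a product is the sup norm, hence [dist2]. *)
Definition dist2 {R : realType} (P Q : R * R) : R :=
  Num.sqrt ((P.1 - Q.1) ^+ 2 + (P.2 - Q.2) ^+ 2).

Definition circle {R : realType} : set (R * R) :=
  [set p | p.1 ^+ 2 + p.2 ^+ 2 = 1].

Definition ellipse {R : realType} (a : R) : set (R * R) :=
  [set P | (P.1 / a) ^+ 2 + P.2 ^+ 2 = 1].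

Definition phi {R : realType} (a : R) (p : R * R) : R * R := (a * p.1, p.2).

Definition cw_rot {R : realType} (t : R) (p : R * R) : R * R :=
  (cos t * p.1 + sin t * p.2, cos t * p.2 - sin t * p.1).

(* Rotating by [t] moves a point of the unit circle along an arc of length [t]. *)
Definition cw_dist {R : realType} (p q : R * R) : R :=
  get [set t : R | 0 <= t < 2 * pi /\ cw_rot t p = q].

Definition cw_arc {R : realType} (p q : R * R) : set (R * R) :=
  [set cw_rot t p | t in [set t : R | 0 <= t <= cw_dist p q]].

(* [(P.1 / a ^+ 2, P.2)] is half the gradient at [P] of the quadratic form
   defining [ellipse a]. *)
Definition normal_line {R : realType} (a : R) (P : R * R) : set (R * R) :=
  [set Q | exists t : R, Q = (P.1 + t * (P.1 / a ^+ 2), P.2 + t * P.2)].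

(* The functions below are total on the plane; their values are meaningful only
   on [circle], and for [1 < a < sqrt 2] and [0 < r < 2]. *)
Definition h {R : realType} (a : R) (p : R * R) : R * R :=
  get [set q : R * R | [/\ circle q, ellipse a (phi a q), phi a q <> phi a p
                         & normal_line a (phi a p) (phi a q)]].

Definition h_inv {R : realType} (a : R) (p : R * R) : R * R :=
  get [set q : R * R | circle q /\ h a q = p].

Definition F {R : realType} (p : R * R) (r a : R) : R * R :=
  let admissible := [set q : R * R | cw_arc p (h_inv a p) q
                                     /\ dist2 (phi a p) (phi a q) <= r] in
  get [set q : R * R | admissible q /\
    forall q', admissible q' ->
      dist2 (phi a p) (phi a q') <= dist2 (phi a p) (phi a q)].

Definition Fiter {R : realType} (n : nat) (p : R * R) (r a : R) : R * R :=
  iter n (fun q => F q r a) p.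

Definition side_length {R : realType} (a : R) (p : R * R) : R :=
  inf [set r : R | 0 < r < 2 /\
    4 * pi <= \sum_(1 <= i < 6) cw_dist (Fiter i p r a) (Fiter i.+1 p r a)].

Definition local_minima {R : realType} {T : topologicalType} (A : set T)
    (f : T -> R) : set T :=
  [set p | A p /\ \forall q \near within A (nbhs p), f p <= f q].

Definition local_maxima {R : realType} {T : topologicalType} (A : set T)
    (f : T -> R) : set T :=
  [set p | A p /\ \forall q \near within A (nbhs p), f q <= f p].

(* Main.v *)
From HB Require Import structures.
From Stdlib Require Import BinInt.
Require Import Defs.
From mathcomp Require Import all_boot all_order all_algebra.
From mathcomp Require Import all_classical all_reals all_analysis.
From mathcomp Require Import ring lra ssrZ zify.

Set Implicit Arguments.
Unset Strict Implicit.
Unset Printing Implicit Defensive.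

Import Order.TTheory GRing.Theory Num.Theory.
Import numFieldNormedType.Exports.

Local Open Scope classical_set_scope.
Local Open Scope card_scope.
Local Open Scope ring_scope.

(** The circle is lifted to the line by [pt x = (cos x, - sin x)], for which
    moving clockwise is increasing [x].  For [1 <= a ^+ 2 <= 2] and [0 < r < 2]
    the map [F] lifts to an increasing homeomorphism [step a r] of the line
    that commutes with the translation by [pi] (central symmetry of the
    ellipse) and is conjugated to its inverse by [x |-> - x] (reflection).  The
    side length at [pt x] is then the only [r = sigma a x] for which five steps
    from [x] close up, that is, end at [x + 4 * pi]; this is
    [side_length_pt].

    All the points [y] whose five steps of length [r] close up satisfy
    [sigma a y = r].  So the level set of [sigma a] through [c] contains, with
    [c], its orbit under [step a r], the antipodes of this orbit, and the
    reflection of all that.  The orbit and its antipodes are ten points of the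
    circle: if [d] steps amount to a translation by [m * pi], then
    [4 * d = 5 * m], so that [d] is a multiple of 5.  The reflected points are
    ten others, unless the star through [c] is symmetric about an axis of the
    ellipse; in that case it has a vertex on an axis.

    Hence it suffices to choose [a] such that the two kinds of symmetric stars,
    those with a vertex at the end of the long axis and those with a vertex at
    the end of the short one, have equal sides: [sigma a 0 = sigma a (pi / 2)].
    Then a level set that meets one of the two kinds contains both, and these
    are unrelated, so every nonempty level set has at least twenty points
    ([card_level_set]).  The continuous function [sigma a] has a global minimum
    and a global maximum on the circle, and each of the points of their level
    sets is a local extremum.

    Such an [a] is given by the intermediate value theorem.  The sign of
    [sigma a 0 - sigma a (pi / 2)] at an explicit rational [a] follows from a
    rational [r] strictly between the two numbers; and [sigma a x < r] is
    certified by one five-pointed polygon through [x], winding twice, all of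
    whose sides are shorter than [r]. *)

(** * Chords of the ellipse *)

Definition pt {R : realType} (x : R) : R * R := (cos x, - sin x).
(** The square of the distance between [phi a (pt x)] and [phi a (pt y)]. *)
Definition chord2 {R : realType} (a x y : R) : R :=
  a ^+ 2 * (cos x - cos y) ^+ 2 + (sin x - sin y) ^+ 2.
(** Half of the derivative of [chord2 a x] at [y], by [is_derive_chord2].  It
    vanishes exactly when the chord is normal to the ellipse at its end [y], by
    [normal_line_slope]. *)
Definition slope {R : realType} (a x y : R) : R :=
  a ^+ 2 * (cos x - cos y) * sin y - (sin x - sin y) * cos y.

(** With the middle angle [m] and the half-width [w] of the chord as
    coordinates, the two variables separate almost completely. *)
Lemma chord2_half (R : realType) (a m w : R) :
  chord2 a (m - w) (m + w) =
  4 * sin w ^+ 2 * (a ^+ 2 * sin m ^+ 2 + cos m ^+ 2).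
Proof. by rewrite /chord2 !cosD !sinD !cosN !sinN; ring. Qed.

Lemma slope_half (R : realType) (a m w : R) :
  slope a (m - w) (m + w) =
  2 * sin w * (cos w * (a ^+ 2 * sin m ^+ 2 + cos m ^+ 2)
               + (a ^+ 2 - 1) * sin m * cos m * sin w).
Proof. by rewrite /slope !cosD !sinD !cosN !sinN; ring. Qed.

(** Reflection in the long axis exchanges the ends of a chord.  Statements on
    how the beginning [x] of a chord varies are deduced through it from those on
    its end [y]. *)
Lemma chord2_opp (R : realType) (a x y : R) :
  chord2 a (- y) (- x) = chord2 a x y.
Proof. by rewrite /chord2 !cosN !sinN; ring. Qed.

Lemma chord2_Dpi (R : realType) (a x y : R) :
  chord2 a (x + pi) (y + pi) = chord2 a x y.
Proof. by rewrite /chord2 !cosDpi !sinDpi; ring. Qed.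

(** A chord spanning more than half a turn is a chord spanning less than half a
    turn, read counterclockwise; the reflection makes it clockwise again. *)
Lemma chord2_flip (R : realType) (a x y : R) :
  chord2 a (- x) (pi *+ 2 - y) = chord2 a x y.
Proof. by rewrite /chord2 ![pi *+ 2 - y]addrC cosD2pi sinD2pi !cosN !sinN; ring. Qed.

Lemma slope_flip (R : realType) (a x y : R) :
  slope a (- x) (pi *+ 2 - y) = - slope a x y.
Proof. by rewrite /slope ![pi *+ 2 - y]addrC cosD2pi sinD2pi !cosN !sinN; ring. Qed.

Lemma is_derive_chord2 (R : realType) (a x y : R) :
  is_derive y 1 (chord2 a x) (2 * slope a x y).
Proof.
rewrite /chord2; apply: is_derive_eq.
rewrite /slope /GRing.scale /=; ring.
Qed.

Lemma continuous_chord2 (R : realType) (a x : R) : continuous (chord2 a x).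
Proof.
move=> y; apply: differentiable_continuous; apply/derivable1_diffP.
by have [] := is_derive_chord2 a x y.
Qed.

(** Applied with [k = a ^+ 2], whose upper bound enters because the inequality
    reduces to [(k - 1) * c ^+ 2 <= 1]. *)
Lemma quadratic_form_gt1 (R : realFieldType) (k s c : R) :
  1 <= k <= 2 -> s ^+ 2 + c ^+ 2 = 1 ->
  ((k - 1) * s * c) ^+ 2 <=
     (k * s ^+ 2 + c ^+ 2 - 1) * (k * s ^+ 2 + c ^+ 2) ^+ 2.
Proof.
move=> /andP[k1 k2] sc.
have s0 : 0 <= s ^+ 2 := sqr_ge0 s.
have c0 : 0 <= c ^+ 2 := sqr_ge0 c.
have k1s : 0 <= (k - 1) * s ^+ 2 by apply: mulr_ge0 => //; lra.
have k2c : 0 <= (2 - k) * c ^+ 2 by apply: mulr_ge0 => //; lra.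
have c1 : (k - 1) * c ^+ 2 <= 1 by nra.
have q1 : 1 <= k * s ^+ 2 + c ^+ 2 by nra.
have -> : k * s ^+ 2 + c ^+ 2 - 1 = (k - 1) * s ^+ 2 by rewrite -[X in _ - X]sc; ring.
set q := k * s ^+ 2 + c ^+ 2 in q1 *.
have -> : ((k - 1) * s * c) ^+ 2 = (k - 1) * s ^+ 2 * ((k - 1) * c ^+ 2) by ring.
apply: ler_wpM2l => //.
by rewrite (le_trans c1)// exprn_ege1.
Qed.

(** As long as it is shorter than the small axis, a chord gets longer when its
    end moves away.  With [q] and [e] as in the proof, the sign of the slope is
    that of [cos w * q + e * sin w]; if it were not positive, then
    [cos w ^+ 2 * q ^+ 2 <= sin w ^+ 2 * e ^+ 2], and [quadratic_form_gt1] would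
    give [1 <= sin w ^+ 2 * q], a quarter of the squared length. *)
Lemma slope_gt0 (R : realType) (a x y : R) :
  1 <= a ^+ 2 <= 2 -> x < y <= x + pi -> chord2 a x y < 4 ->
  0 < slope a x y.
Proof.
move=> ha /andP[xy yx].
pose m := (x + y) / 2; pose w := (y - x) / 2.
have -> : x = m - w by rewrite /m /w; lra.
have -> : y = m + w by rewrite /m /w; lra.
rewrite chord2_half slope_half.
have sw0 : 0 < sin w by apply: sin_gt0_pi; rewrite /w; have := pi_gt0 R; lra.
have cw0 : 0 <= cos w.
  by apply: cos_ge0_pihalf; rewrite /w; have := pi_gt0 R; lra.
have := cos2Dsin2 w; have := cos2Dsin2 m.
have := @quadratic_form_gt1 _ _ (sin m) (cos m) ha.
rewrite addrC => + scm => /(_ scm).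
set q := _ + cos m ^+ 2.
set e := (_ - 1) * _ * _ => eq scw Dlt.
have q1 : 1 <= q.
  by rewrite /q -scm addrC lerD2r ler_peMl ?sqr_ge0//; case/andP: ha.
move: (q) (e) eq q1 Dlt => {}q {}e eq q1 Dlt.
apply: mulr_gt0; first by lra.
rewrite ltNge; apply/negP => le0.
have h1 : (cos w * q) ^+ 2 <= (e * sin w) ^+ 2.
  rewrite -(sqrrN (e * _)); have ? : 0 <= cos w * q by nra.
  by rewrite ler_pXn2r ?nnegrE//; lra.
have h2 : sin w ^+ 2 * q < 1 by lra.
have h3 : cos w ^+ 2 = 1 - sin w ^+ 2 by lra.
rewrite !exprMn h3 in h1.
have h4 : sin w ^+ 2 * e ^+ 2 <= sin w ^+ 2 * ((q - 1) * q ^+ 2).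
  by apply: ler_wpM2l => //; exact: sqr_ge0.
have h5 : q ^+ 2 <= sin w ^+ 2 * q * q ^+ 2 by lra.
have : sin w ^+ 2 * q * q ^+ 2 < q ^+ 2 by rewrite gtr_pMl// exprn_gt0//; lra.
by rewrite ltNge h5.
Qed.

(** No normal chord is shorter than the small axis. *)
Lemma slope_eq0_chord2 (R : realType) (a x y : R) :
  1 <= a ^+ 2 <= 2 -> x < y < x + pi *+ 2 -> slope a x y = 0 ->
  4 <= chord2 a x y.
Proof.
move=> ha /andP[xy yx] s0; rewrite leNgt; apply/negP => D4.
have [le|gt] := leP y (x + pi).
  suff : 0 < slope a x y by rewrite s0 ltxx.
  by apply: slope_gt0 => //; rewrite xy.
suff : 0 < slope a (- x) (pi *+ 2 - y) by rewrite slope_flip s0 oppr0 ltxx.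
apply: slope_gt0 => //; last by rewrite chord2_flip.
by move: yx; rewrite mulr2n; lra.
Qed.

Lemma derive_gt0_left (R : realType) (f : R -> R) (c d : R) :
  is_derive c 1 f d -> 0 < d ->
  exists2 e, 0 < e & forall t, c - e < t < c -> f t < f c.
Proof.
move=> [df <-] d0.
have [e /= e0 He] := @cvgr_gt _ _ _ _ (fun h => h^-1 *: (f (h *: 1 + c) - f c)) _ df _ d0.
exists e => // t /andP[t1 t2].
have := He (t - c).
rewrite /= sub0r normrN.
have -> : `|t - c| < e by rewrite ltr_norml; lra.
have -> : t - c != 0 by rewrite subr_eq0 lt_eqF.
move=> /(_ isT isT).
rewrite /GRing.scale /= mulr1 subrK.
have tc : (t - c)^-1 < 0 by rewrite invr_lt0 subr_lt0.
by rewrite nmulr_rgt0// subr_lt0.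
Qed.

(** Monotonicity does not follow from [slope_gt0] directly, because the chords
    between [y1] and [y2] could a priori be long.  But if the chord to [y1] were
    the longer one, the shortest chord ending in the interval would end after
    [y1], where [slope_gt0] makes an earlier end better. *)
Lemma chord2_homo (R : realType) (a x y1 y2 : R) :
  1 <= a ^+ 2 <= 2 -> x <= y1 -> y1 < y2 -> y2 <= x + pi ->
  chord2 a x y2 < 4 -> chord2 a x y1 < chord2 a x y2.
Proof.
move=> ha xy1 y12 y2pi D2; rewrite ltNge; apply/negP => D12.
have [|c /[!in_itv] /= /andP[c1 c2] cmin] := @EVT_min R (chord2 a x) y1 y2 (ltW y12).
  by apply: continuous_subspaceT; exact: continuous_chord2.
have [c' [c'1 c'2 c'min]] : exists c', [/\ y1 < c', c' <= y2 &
    forall t, y1 <= t <= y2 -> chord2 a x c' <= chord2 a x t].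
  move: c1; rewrite le_eqVlt => /predU1P[cy1|y1c]; last first.
    by exists c; split => // t ht; apply: cmin; rewrite in_itv.
  exists y2; split => // t ht; apply: (le_trans D12).
  by rewrite cy1; apply: cmin; rewrite in_itv.
have Dc' : chord2 a x c' < 4.
  by apply: le_lt_trans D2; apply: c'min; rewrite lexx ltW.
have s0 : 0 < slope a x c' by apply: slope_gt0 => //; lra.
have [|e e0 he] := derive_gt0_left (is_derive_chord2 a x c'); first by lra.
pose t := Num.max y1 (c' - e / 2).
have t1 : y1 <= t by rewrite /t le_max lexx.
have t2 : c' - e / 2 <= t by rewrite /t le_max lexx orbT.
have t3 : t < c' by rewrite /t gt_max c'1 /=; lra.
have /he : c' - e < t < c' by lra.
by rewrite ltNge c'min// t1 (le_trans (ltW t3)).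
Qed.

(** * The chord map *)

(** The lift of [F] to the line, by [F_pt]. *)
Definition step {R : realType} (a r x : R) : R :=
  get [set y : R | x <= y <= x + pi /\ chord2 a x y = r ^+ 2].

Lemma chord2_diag (R : realType) (a x : R) : chord2 a x x = 0.
Proof. by rewrite /chord2 !subrr; ring. Qed.

Lemma chord2_antipode (R : realType) (a x : R) :
  1 <= a ^+ 2 -> 4 <= chord2 a x (x + pi).
Proof.
move=> a1; rewrite /chord2 cosDpi sinDpi.
have -> : 4 = 4 * (cos x ^+ 2 + sin x ^+ 2) :> R by rewrite cos2Dsin2 mulr1.
have : 0 <= (a ^+ 2 - 1) * cos x ^+ 2.
  by apply: mulr_ge0; [lra|exact: sqr_ge0].
lra.
Qed.

Lemma sqr_lt4 (R : realType) (r : R) : 0 < r < 2 -> r ^+ 2 < 4.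
Proof. by move=> h; rewrite expr2; nra. Qed.

Lemma stepP (R : realType) (a r x : R) :
  1 <= a ^+ 2 <= 2 -> 0 < r < 2 ->
  x <= step a r x <= x + pi /\ chord2 a x (step a r x) = r ^+ 2.
Proof.
move=> /andP[a1 _] hr; rewrite /step.
apply: (@getPex _ [set y : R | x <= y <= x + pi /\ chord2 a x y = r ^+ 2]).
have [|||y + yr] := @IVT R (chord2 a x) x (x + pi) (r ^+ 2).
- by have := pi_gt0 R; lra.
- by apply: continuous_subspaceT; exact: continuous_chord2.
- rewrite chord2_diag; have := chord2_antipode x a1; have := sqr_lt4 hr => r4 D4.
  by rewrite le_max ge_min sqr_ge0/= (ltW (lt_le_trans r4 D4)) orbT.
- by rewrite in_itv /= => hy; exists y.
Qed.

(** With [step_lt], this turns any question about the position of [step a r x]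
    into one about the length of an explicit chord. *)
Lemma lt_step (R : realType) (a r x y : R) :
  1 <= a ^+ 2 <= 2 -> 0 < r < 2 -> x <= y <= x + pi ->
  (y < step a r x) = (chord2 a x y < r ^+ 2).
Proof.
move=> ha hr /andP[xy ypi].
have [/andP[xs spi] sr] := stepP x ha hr.
have r4 := sqr_lt4 hr.
have [ys|sy|->] := ltgtP y (step a r x); last by rewrite sr ltxx.
  by rewrite -sr; symmetry; apply: chord2_homo => //; rewrite sr.
apply/esym/negbTE; rewrite -leNgt leNgt; apply/negP => Dr.
have := chord2_homo ha xs sy ypi (lt_trans Dr r4).
by rewrite sr ltNge (ltW Dr).
Qed.

Lemma step_lt (R : realType) (a r x y : R) :
  1 <= a ^+ 2 <= 2 -> 0 < r < 2 -> x <= y <= x + pi ->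
  (step a r x < y) = (r ^+ 2 < chord2 a x y).
Proof.
move=> ha hr /andP[xy ypi].
have [/andP[xs spi] sr] := stepP x ha hr.
have r4 := sqr_lt4 hr.
have [ys|sy|->] := ltgtP y (step a r x); last by rewrite sr ltxx.
  apply/esym/negbTE; rewrite -leNgt ltW// -lt_step//; exact/andP.
rewrite ltNge; apply/esym/negP => Dr.
have := chord2_homo ha xs sy ypi (le_lt_trans Dr r4).
by rewrite sr ltNge Dr.
Qed.

Lemma step_unique (R : realType) (a r x y : R) :
  1 <= a ^+ 2 <= 2 -> 0 < r < 2 -> x <= y <= x + pi ->
  chord2 a x y = r ^+ 2 -> step a r x = y.
Proof.
move=> ha hr hy Dr; apply/eqP.
by rewrite eq_le !leNgt lt_step// step_lt// Dr ltxx.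
Qed.

Lemma step_bounds (R : realType) (a r x : R) :
  1 <= a ^+ 2 <= 2 -> 0 < r < 2 -> x < step a r x < x + pi.
Proof.
move=> ha hr; have p0 := pi_gt0 R; have /andP[r0 _] := hr.
rewrite lt_step// ?step_lt// ?lexx ?lerDl ?ltW// chord2_diag exprn_gt0//=.
by rewrite (lt_le_trans (sqr_lt4 hr))// chord2_antipode//; case/andP: ha.
Qed.

(** The reflection conjugates [step a r] to its inverse. *)
Lemma step_opp (R : realType) (a r x : R) :
  1 <= a ^+ 2 <= 2 -> 0 < r < 2 -> step a r (- step a r x) = - x.
Proof.
move=> ha hr; have [/andP[xs sx] sr] := stepP x ha hr.
by apply: step_unique => //; rewrite ?chord2_opp//; lra.
Qed.

Lemma stepDpi (R : realType) (a r x : R) :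
  1 <= a ^+ 2 <= 2 -> 0 < r < 2 -> step a r (x + pi) = step a r x + pi.
Proof.
move=> ha hr; have [/andP[xs sx] sr] := stepP x ha hr.
by apply: step_unique => //; rewrite ?chord2_Dpi//; lra.
Qed.

(** If [step a r x1] were not before [y := step a r x2], then the chord from
    [x1] to [y] would be no longer than [r], and moving its beginning from [x1]
    to [x2] would shorten it strictly; but the chord from [x2] to [y] has length
    [r]. *)
Lemma step_homo (R : realType) (a r : R) :
  1 <= a ^+ 2 <= 2 -> 0 < r < 2 -> {homo step a r : x y / x < y}.
Proof.
move=> ha hr x1 x2 x12; rewrite ltNge; apply/negP => y21.
have [/andP[x1s sx1] sr1] := stepP x1 ha hr.
have /andP[x2s sx2] := step_bounds x2 ha hr.
have sr2 := (stepP x2 ha hr).2.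
set y := step a r x2 in y21 x2s sx2 sr2.
have D1 : chord2 a x1 y <= r ^+ 2 by rewrite leNgt -step_lt// -?leNgt//; lra.
have D14 := le_lt_trans D1 (sqr_lt4 hr).
suff : chord2 a (- y) (- x2) < chord2 a (- y) (- x1).
  by rewrite !chord2_opp sr2 ltNge D1.
by apply: chord2_homo => //; rewrite ?chord2_opp//; lra.
Qed.

Lemma step_homo_r (R : realType) (a r1 r2 x : R) :
  1 <= a ^+ 2 <= 2 -> 0 < r1 -> r1 < r2 -> r2 < 2 ->
  step a r1 x < step a r2 x.
Proof.
move=> ha r10 r12 r22.
have hr1 : 0 < r1 < 2 by lra.
have [hs sr] := stepP x ha hr1.
rewrite lt_step//; last lra.
by rewrite sr ltr_pXn2r ?nnegrE//; lra.
Qed.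

(** A chord spanning a quarter turn has length at least the square root of 2. *)
Lemma step_lt_quarter (R : realType) (a x : R) :
  1 <= a ^+ 2 <= 2 -> step a 1 x < x + pi / 2.
Proof.
move=> ha; have p0 := pi_gt0 R; rewrite step_lt//; [|lra..].
rewrite /chord2 cosDpihalf sinDpihalf.
have /andP[a1 _] := ha.
have : 0 <= (a ^+ 2 - 1) * (cos x + sin x) ^+ 2.
  by apply: mulr_ge0; [lra|exact: sqr_ge0].
by have := cos2Dsin2 x; nra.
Qed.

(** An end of the small axis is at distance less than 2 from every point of the
    ellipse but the opposite end. *)
Lemma chord2_pole_lt4 (R : realType) (a y z : R) :
  a ^+ 2 <= 2 -> cos z = 0 -> z < y <= z + pi -> chord2 a y (z + pi) < 4.
Proof.
move=> a2 cz /andP[zy yz].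
have sz : sin z ^+ 2 = 1 by have := cos2Dsin2 z; rewrite cz expr0n /= add0r.
have sy : sin y = sin z * cos (y - z).
  by rewrite -{1}(subrK z y) sinD cz mulr0 add0r mulrC.
have c1 : cos (y - z) < 1.
  rewrite lt_neqAle cos_le1 andbT -cos0; apply/negP => /eqP.
  by move=> /cos_inj; rewrite !in_itv /= => H; have := H; lra.
rewrite /chord2 cosDpi sinDpi cz oppr0 subr0.
have cm1 : -1 <= cos (y - z) := cos_geN1 _.
have := cos2Dsin2 y; rewrite sy; set t := cos (y - z) in c1 cm1 *.
move: (sin z) sz => e e1 cy.
have -> : cos y ^+ 2 = 1 - t ^+ 2 by move: cy; rewrite exprMn e1; lra.
have -> : (e * t - - e) ^+ 2 = (t + 1) ^+ 2.
  by rewrite opprK -{2}(mulr1 e) -mulrDr exprMn e1 mul1r.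
have t2 : 0 <= (2 - a ^+ 2) * (1 - t ^+ 2).
  by apply: mulr_ge0; [lra|have : 0 <= (1 - t) * (1 + t) by apply: mulr_ge0; lra]; lra.
have : 0 < (1 - t) ^+ 2 by rewrite exprn_gt0 // subr_gt0.
by lra.
Qed.

Lemma chord2_cvg (R : realType) (T : Type) (F : set_system T) (FF : Filter F)
    (a_ x_ : T -> R) (a x y : R) :
  a_ @ F --> a -> x_ @ F --> x ->
  chord2 (a_ t) (x_ t) y @[t --> F] --> chord2 a x y.
Proof.
move=> Fa Fx.
have Fc : cos (x_ t) @[t --> F] --> cos x.
  by apply: continuous_cvg Fx; exact: continuous_cos.
have Fs : sin (x_ t) @[t --> F] --> sin x.
  by apply: continuous_cvg Fx; exact: continuous_sin.
have Fd : (cos (x_ t) - cos y) @[t --> F] --> cos x - cos y.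
  by apply: cvgB Fc _; exact: cvg_cst.
have Fe : (sin (x_ t) - sin y) @[t --> F] --> sin x - sin y.
  by apply: cvgB Fs _; exact: cvg_cst.
rewrite /chord2; apply: cvgD.
  by apply: cvgM; rewrite expr2; apply: cvgM.
by rewrite expr2; apply: cvgM.
Qed.

(** Comparing chords with [r] at two points [u] and [v] around [step a r x] traps
    [step] for all parameters close to [a], [r] and [x]. *)
Lemma step_cvg (R : realType) (T : Type) (F : set_system T) (FF : Filter F)
    (a_ r_ x_ : T -> R) (a r x : R) :
  1 <= a ^+ 2 <= 2 -> 0 < r < 2 ->
  (\forall t \near F, 1 <= a_ t ^+ 2 <= 2) ->
  (\forall t \near F, 0 < r_ t < 2) ->
  a_ @ F --> a -> r_ @ F --> r -> x_ @ F --> x ->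
  step (a_ t) (r_ t) (x_ t) @[t --> F] --> step a r x.
Proof.
move=> ha hr Fha Fhr Fa Fr Fx; apply/cvgrPdist_lt => e e0.
have /andP[xs sx] := step_bounds x ha hr.
set s := step a r x in xs sx *.
pose u := Num.max (s - e) ((x + s) / 2).
pose v := Num.min (s + e) ((x + pi + s) / 2).
have [u1 u2] : s - e <= u /\ (x + s) / 2 <= u by rewrite /u !le_max !lexx orbT.
have us : u < s by rewrite /u gt_max; lra.
have [v1 v2] : v <= s + e /\ v <= (x + pi + s) / 2.
  by rewrite /v !ge_min !lexx orbT.
have sv : s < v by rewrite /v lt_min; lra.
have Fr2 : r_ t ^+ 2 @[t --> F] --> r ^+ 2 by rewrite expr2; apply: cvgM.
have Fu : (chord2 (a_ t) (x_ t) u - r_ t ^+ 2) @[t --> F] --> chord2 a x u - r ^+ 2.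
  by apply: cvgB => //; apply: chord2_cvg.
have Fv : (chord2 (a_ t) (x_ t) v - r_ t ^+ 2) @[t --> F] --> chord2 a x v - r ^+ 2.
  by apply: cvgB => //; apply: chord2_cvg.
have Du : chord2 a x u - r ^+ 2 < 0 by rewrite subr_lt0 -lt_step//; lra.
have Dv : 0 < chord2 a x v - r ^+ 2 by rewrite subr_gt0 -step_lt//; lra.
have xu : x < u by lra.
have vx : v - pi < x by lra.
near=> t.
have hat : 1 <= a_ t ^+ 2 <= 2 by near: t.
have hrt : 0 < r_ t < 2 by near: t.
have xtu : x_ t < u by near: t; exact: (cvgr_lt _ Fx).
have vxt : v - pi < x_ t by near: t; exact: (cvgr_gt _ Fx).
have Dut : chord2 (a_ t) (x_ t) u - r_ t ^+ 2 < 0.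
  by near: t; exact: (cvgr_lt _ Fu).
have Dvt : 0 < chord2 (a_ t) (x_ t) v - r_ t ^+ 2.
  by near: t; exact: (cvgr_gt _ Fv).
have lt1 : u < step (a_ t) (r_ t) (x_ t) by rewrite lt_step//; lra.
have lt2 : step (a_ t) (r_ t) (x_ t) < v by rewrite step_lt//; lra.
by rewrite ltr_norml; lra.
Unshelve. all: by end_near. Qed.

Lemma iter_step_cvg (R : realType) (T : Type) (F : set_system T) (FF : Filter F)
    (a_ r_ x_ : T -> R) (a r x : R) (n : nat) :
  1 <= a ^+ 2 <= 2 -> 0 < r < 2 ->
  (\forall t \near F, 1 <= a_ t ^+ 2 <= 2) ->
  (\forall t \near F, 0 < r_ t < 2) ->
  a_ @ F --> a -> r_ @ F --> r -> x_ @ F --> x ->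
  iter n (step (a_ t) (r_ t)) (x_ t) @[t --> F] --> iter n (step a r) x.
Proof.
move=> ha hr Fha Fhr Fa Fr Fx; elim: n => //= n IHn.
exact: step_cvg.
Qed.

Lemma step_gt (R : realType) (a r x : R) :
  1 <= a ^+ 2 <= 2 -> 0 < r < 2 -> x < step a r x.
Proof. by move=> ha hr; have /andP[] := step_bounds x ha hr. Qed.

Lemma step_le_homo (R : realType) (a r : R) :
  1 <= a ^+ 2 <= 2 -> 0 < r < 2 -> {homo step a r : x y / x <= y}.
Proof. by move=> ha hr; apply: ltW_homo; exact: step_homo. Qed.

Lemma iter_step_homo_r (R : realType) (a r1 r2 x : R) (n : nat) :
  1 <= a ^+ 2 <= 2 -> 0 < r1 -> r1 < r2 -> r2 < 2 ->
  iter n.+1 (step a r1) x < iter n.+1 (step a r2) x.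
Proof.
move=> ha r10 r12 r22; have hr2 : 0 < r2 < 2 by lra.
elim: n => [|n IHn]; first exact: step_homo_r.
rewrite iterS [ltRHS]iterS.
apply: lt_trans (step_homo_r _ ha r10 r12 r22) _.
exact: step_homo.
Qed.

Lemma iter_step_le_r (R : realType) (a r1 r2 x : R) (n : nat) :
  1 <= a ^+ 2 <= 2 -> 0 < r1 -> r1 <= r2 -> r2 < 2 ->
  iter n (step a r1) x <= iter n (step a r2) x.
Proof.
move=> ha r10; rewrite le_eqVlt => /predU1P[->//|r12] r22.
case: n => [|n]; first exact: lexx.
by apply/ltW; exact: iter_step_homo_r.
Qed.

(** For [r] close to 2 a step almost reaches the opposite end of the small axis,
    so a point that is past one end stays past the next ends in turn.  The
    length [r] has to be increased at each step. *)
Lemma iter_step_pole (R : realType) (a x z : R) (n : nat) :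
  1 <= a ^+ 2 <= 2 -> cos z = 0 -> z < x ->
  exists2 r, 0 < r < 2 & z + n%:R * pi < iter n (step a r) x.
Proof.
move=> ha cz zx; elim: n => [|n [r hr IHn]].
  by exists 1; [lra|rewrite mul0r addr0].
set zn := z + n%:R * pi in IHn.
have czn : cos zn = 0.
  rewrite /zn mulr_natl; elim: (n) => [|k ck]; first by rewrite addr0.
  by rewrite mulrSr addrA cosDpi ck oppr0.
have -> : z + n.+1%:R * pi = zn + pi by rewrite /zn -natr1; ring.
set y := iter n (step a r) x in IHn.
have [yz|zy] := leP y (zn + pi); last first.
  by exists r => //; apply: lt_trans zy _; exact: step_gt.
have D4 : chord2 a y (zn + pi) < 4.
  by apply: chord2_pole_lt4 => //; [case/andP: ha|rewrite IHn].
set D := chord2 a y (zn + pi) in D4.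
have D0 : 0 <= D by apply: addr_ge0; [apply: mulr_ge0|]; exact: sqr_ge0.
(* [(1 + D / 4) ^+ 2 - D] is the square of [1 - D / 4]. *)
pose r' := Num.max r (1 + D / 4).
have r1 : r <= r' by rewrite le_max lexx.
have r2 : 1 + D / 4 <= r' by rewrite le_max lexx orbT.
have r3 : r' < 2 by rewrite gt_max; lra.
have hr' : 0 < r' < 2 by lra.
exists r' => //; apply: (@lt_le_trans _ _ (step a r' y)); last first.
  by apply: step_le_homo => //; apply: iter_step_le_r => //; lra.
rewrite lt_step//; last by lra.
apply: (@lt_le_trans _ _ ((1 + D / 4) ^+ 2)).
  have : 0 < (1 - D / 4) ^+ 2 by rewrite exprn_gt0//; lra.
  by rewrite -/D; lra.
by rewrite ler_pXn2r ?nnegrE//; lra.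
Qed.

Lemma cos_zero_before (R : realType) (x : R) :
  exists2 z : R, cos z = 0 & x - pi <= z < x.
Proof.
have p0 := pi_gt0 R.
have cp : cos (x - pi) = - cos x by rewrite -{2}(subrK pi x) cosDpi opprK.
have [|||z] := @IVT R cos (x - pi) x 0.
- by lra.
- by apply: continuous_subspaceT; exact: continuous_cos.
- rewrite cp ge_min le_max oppr_le0 oppr_ge0.
  by have [_|/ltW ->] := leP 0 (cos x); rewrite ?orbT.
rewrite in_itv /= => /andP[z1]; rewrite le_eqVlt => /predU1P[->|zx] cz.
  by exists (x - pi); rewrite ?cp ?cz ?oppr0// lexx; lra.
by exists z => //; rewrite z1.
Qed.

(** Five steps from past the end [z] reach beyond [z + 5 * pi >= x + 4 * pi]. *)
Lemma iter5_step_large (R : realType) (a x : R) :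
  1 <= a ^+ 2 <= 2 ->
  exists2 r, 0 < r < 2 & x + 4 * pi < iter 5 (step a r) x.
Proof.
move=> ha; have [z cz /andP[z1 z2]] := cos_zero_before x.
have [r hr hz] := iter_step_pole 5 ha cz z2.
by exists r => //; apply: le_lt_trans hz; lra.
Qed.

Lemma iter5_step_small (R : realType) (a x : R) :
  1 <= a ^+ 2 <= 2 -> iter 5 (step a 1) x < x + 4 * pi.
Proof.
move=> ha; have p0 := pi_gt0 R.
have q y := @step_lt_quarter R a y ha.
set y1 := step a 1 x; have := q x; rewrite -/y1 => h1.
have h2 := q y1; have h3 := q (step a 1 y1).
have h4 := q (step a 1 (step a 1 y1)).
have h5 := q (step a 1 (step a 1 (step a 1 y1))).
by rewrite /= -/y1; lra.
Qed.

(** * The length of the sides of a closed star *)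
Definition sigma {R : realType} (a x : R) : R :=
  get [set r : R | 0 < r < 2 /\ iter 5 (step a r) x = x + 4 * pi].

(** Existence is the intermediate value theorem in [r], between steps that are
    too short to wind twice and steps that are long enough. *)
Lemma sigmaP (R : realType) (a x : R) :
  1 <= a ^+ 2 <= 2 ->
  0 < sigma a x < 2 /\ iter 5 (step a (sigma a x)) x = x + 4 * pi.
Proof.
move=> ha; rewrite /sigma.
apply: (@getPex _ [set r : R | 0 < r < 2 /\ iter 5 (step a r) x = x + 4 * pi]).
have [r hr xr] := iter5_step_large x ha.
have r1 : 1 < r.
  rewrite ltNge; apply/negP => r1.
  have := @iter_step_le_r R a r 1 x 5 ha; have := iter5_step_small x ha.
  by move=> h1 h2; have : iter 5 (step a r) x <= iter 5 (step a 1) x; [apply: h2|]; lra.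
have [|||c] := @IVT R (fun r => iter 5 (step a r) x) 1 r (x + 4 * pi).
- exact: ltW.
- apply: continuous_in_subspaceT => c; rewrite inE /= in_itv /= => hc.
  apply: (@iter_step_cvg R R (nbhs c) _ (fun=> a) id (fun=> x) a c x 5) => //;
    try exact: cvg_cst; try exact: cvg_id.
  + by lra.
  + by near=> t.
  + near=> t; apply/andP; split; near: t.
      by apply: lt_nbhsr; lra.
    by apply: lt_nbhsl; lra.
- by rewrite ge_min le_max (ltW xr) orbT (ltW (iter5_step_small _ _)).
- by rewrite in_itv /= => hc cE; exists c; split => //; lra.
Unshelve. all: by end_near. Qed.

(** With [sigma_lt], this decides the position of [sigma a x] by looking at five
    steps of an arbitrary length [r]. *)
Lemma lt_sigma (R : realType) (a r x : R) :
  1 <= a ^+ 2 <= 2 -> 0 < r < 2 ->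
  (r < sigma a x) = (iter 5 (step a r) x < x + 4 * pi).
Proof.
move=> ha hr; have [hs sE] := sigmaP x ha.
have [rs|sr|->] := ltgtP r (sigma a x); last by rewrite sE ltxx.
  by rewrite -sE; symmetry; apply: iter_step_homo_r => //; lra.
apply/esym/negbTE; rewrite -leNgt -sE; apply: iter_step_le_r => //; lra.
Qed.

Lemma sigma_lt (R : realType) (a r x : R) :
  1 <= a ^+ 2 <= 2 -> 0 < r < 2 ->
  (sigma a x < r) = (x + 4 * pi < iter 5 (step a r) x).
Proof.
move=> ha hr; have [hs sE] := sigmaP x ha.
have [rs|sr|->] := ltgtP r (sigma a x); last by rewrite sE ltxx.
  apply/esym/negbTE; rewrite -leNgt -sE; apply: iter_step_le_r => //; lra.
by rewrite -sE; symmetry; apply: iter_step_homo_r => //; lra.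
Qed.

Lemma sigma_unique (R : realType) (a r x : R) :
  1 <= a ^+ 2 <= 2 -> 0 < r < 2 -> iter 5 (step a r) x = x + 4 * pi ->
  sigma a x = r.
Proof.
move=> ha hr rE; apply/eqP.
by rewrite eq_le !leNgt lt_sigma// sigma_lt// rE ltxx.
Qed.

Lemma sigma_cvg (R : realType) (T : Type) (F : set_system T) (FF : Filter F)
    (a_ x_ : T -> R) (a x : R) :
  1 <= a ^+ 2 <= 2 -> (\forall t \near F, 1 <= a_ t ^+ 2 <= 2) ->
  a_ @ F --> a -> x_ @ F --> x ->
  sigma (a_ t) (x_ t) @[t --> F] --> sigma a x.
Proof.
move=> ha Fha Fa Fx; apply/cvgrPdist_lt => e e0.
have [hs _] := sigmaP x ha; set s := sigma a x in hs *.
pose u := Num.max (s - e) (s / 2); pose v := Num.min (s + e) ((s + 2) / 2).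
have [u1 u2] : s - e <= u /\ s / 2 <= u by rewrite /u !le_max !lexx orbT.
have us : u < s by rewrite /u gt_max; lra.
have [v1 v2] : v <= s + e /\ v <= (s + 2) / 2 by rewrite /v !ge_min !lexx orbT.
have sv : s < v by rewrite /v lt_min; lra.
have hu : 0 < u < 2 by lra.
have hv : 0 < v < 2 by lra.
have F5 w : 0 < w < 2 ->
    (iter 5 (step (a_ t) w) (x_ t) - x_ t) @[t --> F] --> iter 5 (step a w) x - x.
  move=> hw; apply: cvgB => //.
  apply: (@iter_step_cvg R T F _ a_ (fun=> w) x_) => //; last exact: cvg_cst.
  by near=> t.
have Nu : iter 5 (step a u) x - x < 4 * pi by rewrite ltrBlDl -lt_sigma.
have Nv : 4 * pi < iter 5 (step a v) x - x by rewrite ltrBrDl -sigma_lt.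
near=> t.
have hat : 1 <= a_ t ^+ 2 <= 2 by near: t.
have lt1 : u < sigma (a_ t) (x_ t).
  by rewrite lt_sigma// -ltrBlDl; near: t; exact: (cvgr_lt _ (F5 _ hu)).
have lt2 : sigma (a_ t) (x_ t) < v.
  by rewrite sigma_lt// -ltrBrDl; near: t; exact: (cvgr_gt _ (F5 _ hv)).
by rewrite ltr_norml; lra.
Unshelve. all: by end_near. Qed.

(** * Identification of the side-length function *)
Lemma circle_pt (R : realType) (x : R) : circle (pt x).
Proof. by rewrite /circle /pt /= sqrrN cos2Dsin2. Qed.

Lemma cw_rot_pt (R : realType) (t x : R) : cw_rot t (pt x) = pt (x + t).
Proof. by rewrite /cw_rot /pt /= cosD sinD; congr pair; ring. Qed.

Lemma ptD2pi (R : realType) (x : R) : pt (x + pi *+ 2) = pt x.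
Proof. by rewrite /pt cosD2pi sinD2pi. Qed.

Lemma pt_surj0 (R : realType) (p : R * R) :
  circle p -> exists2 t, 0 <= t < 2 * pi & p = pt t.
Proof.
case: p => c s; rewrite /circle /= => cs; have p0 := pi_gt0 R.
have c1 : -1 <= c <= 1 by have := sqr_ge0 s; nra.
have hc : cos (acos c) = c by rewrite acosK// in_itv.
have s2 : 1 - c ^+ 2 = s ^+ 2 by lra.
have hs : sin (acos c) = `|s| by rewrite sin_acos// s2 sqrtr_sqr.
have a0 := acos_ge0 c1; have api := acos_lepi c1.
have [s0|s0] := leP s 0.
  exists (acos c); first by lra.
  by rewrite /pt hc hs ler0_norm// opprK.
exists (pi *+ 2 - acos c); last first.
  by rewrite /pt addrC cosD2pi sinD2pi cosN sinN hc hs gtr0_norm// opprK.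
suff ac0 : acos c != 0.
  by have : 0 < acos c; [rewrite lt0r ac0|lra].
apply/negP => /eqP ac0; move: hs; rewrite ac0 sin0 gtr0_norm//.
by move=> s00; rewrite -s00 ltxx in s0.
Qed.

Lemma pt_surj (R : realType) (x : R) (p : R * R) :
  circle p -> exists2 t, 0 <= t < 2 * pi & p = pt (x + t).
Proof.
move=> cp; have [y _ py] := pt_surj0 cp.
have [t ht pE] := pt_surj0 (circle_pt (y - x)).
exists t => //; have -> : p = cw_rot x (pt (y - x)) by rewrite cw_rot_pt subrK.
by rewrite pE cw_rot_pt addrC.
Qed.

Lemma pt_inj (R : realType) (x y : R) :
  x <= y < x + 2 * pi -> pt x = pt y -> x = y.
Proof.
move=> hxy [cE sE]; have p0 := pi_gt0 R.
have c1 : cos (y - x) = 1.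
  by rewrite cosB -cE -(oppr_inj sE) -!expr2 cos2Dsin2.
have [le|gt] := leP (y - x) pi.
  have : y - x = 0 by apply: cos_inj; rewrite ?in_itv/= ?cos0//; lra.
  by lra.
have : pi *+ 2 - (y - x) = 0.
  by apply: cos_inj; rewrite ?in_itv/= ?cos0 ?[_ *+ 2 - _]addrC ?cosD2pi ?cosN//; lra.
by lra.
Qed.

Lemma cw_dist_pt (R : realType) (x y : R) :
  x <= y < x + 2 * pi -> cw_dist (pt x) (pt y) = y - x.
Proof.
move=> hxy; rewrite /cw_dist; apply: get_unique => [|t /= [ht]].
  by rewrite /= cw_rot_pt subrKC; split => //; lra.
rewrite cw_rot_pt => ptE.
have [le|gt] := leP (x + t) y.
  by have := pt_inj _ ptE; lra.
by have := pt_inj _ (esym ptE); lra.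
Qed.

Lemma dist2_phi (R : realType) (a x y : R) :
  dist2 (phi a (pt x)) (phi a (pt y)) = Num.sqrt (chord2 a x y).
Proof. by rewrite /dist2 /phi /pt /chord2 /=; congr Num.sqrt; ring. Qed.

Lemma chord2_ge0 (R : realType) (a x y : R) : 0 <= chord2 a x y.
Proof. by apply: addr_ge0; [apply: mulr_ge0|]; exact: sqr_ge0. Qed.

Lemma dist2_phi_le (R : realType) (a r x y : R) : 0 < r ->
  (dist2 (phi a (pt x)) (phi a (pt y)) <= r) = (chord2 a x y <= r ^+ 2).
Proof.
move=> r0; rewrite dist2_phi -{1}(ger0_norm (ltW r0)) -sqrtr_sqr.
by rewrite ler_sqrt// sqr_ge0.
Qed.

Lemma ellipse_phi (R : realType) (a : R) (p : R * R) :
  a != 0 -> circle p -> ellipse a (phi a p).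
Proof.
by move=> a0; rewrite /circle /ellipse /phi /= mulrAC divff// mul1r.
Qed.

Lemma phi_inj (R : realType) (a : R) : a != 0 -> injective (phi a).
Proof.
by move=> a0 [p1 p2] [q1 q2] [/(mulfI a0) -> ->].
Qed.

(** The candidates for [h a q]. *)
Definition normal_chord {R : realType} (a : R) (q : R * R) : set (R * R) :=
  [set p : R * R | [/\ circle p, ellipse a (phi a p), phi a p <> phi a q
                     & normal_line a (phi a q) (phi a p)]].

Lemma normal_denom_gt0 (R : realType) (k : R) (q : R * R) :
  0 < k -> circle q -> 0 < k ^+ 2 * q.1 ^+ 2 + q.2 ^+ 2.
Proof.
rewrite /circle /= => k0 cq.
have [c0|c0] := eqVneq q.1 0.
  by move: cq; rewrite c0 expr0n /= mulr0 !add0r => ->.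
apply: ltr_wpDr; first exact: sqr_ge0.
by apply: mulr_gt0; [exact: exprn_gt0|rewrite exprn_even_gt0].
Qed.

(** The second intersection of the normal with the ellipse: one root of the
    quadratic equation is the point [phi a q] itself. *)
Lemma normal_param (R : realType) (a t : R) (q p : R * R) :
  a != 0 -> circle q -> circle p ->
  phi a p = ((phi a q).1 + t * ((phi a q).1 / a ^+ 2), (phi a q).2 + t * (phi a q).2) ->
  t * (t * ((a ^- 2) ^+ 2 * q.1 ^+ 2 + q.2 ^+ 2) + 2 * (a ^- 2 * q.1 ^+ 2 + q.2 ^+ 2)) = 0.
Proof.
move=> a0; rewrite /circle /= => cq cp [p1E p2E].
have p1 : p.1 = q.1 + t * q.1 * a ^- 2.
  by apply: (mulfI a0); rewrite p1E; ring.
rewrite /= in p2E; rewrite p1 p2E in cp.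
have : (q.1 + t * q.1 * a ^- 2) ^+ 2 + (q.2 + t * q.2) ^+ 2
       - (q.1 ^+ 2 + q.2 ^+ 2) = 0 by rewrite cp cq subrr.
by move=> <-; ring.
Qed.

Lemma normal_chord_unique (R : realType) (a : R) (q p1 p2 : R * R) :
  a != 0 -> circle q -> normal_chord a q p1 -> normal_chord a q p2 -> p1 = p2.
Proof.
move=> a0 cq [c1 _ n1 [t1 t1E]] [c2 _ n2 [t2 t2E]].
have k0 : 0 < a ^- 2 by rewrite invr_gt0 exprn_even_gt0.
have d0 := normal_denom_gt0 k0 cq.
have tn0 p t : phi a p <> phi a q -> circle p ->
    phi a p = ((phi a q).1 + t * ((phi a q).1 / a ^+ 2),
               (phi a q).2 + t * (phi a q).2) ->
    t * ((a ^- 2) ^+ 2 * q.1 ^+ 2 + q.2 ^+ 2) =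
    - (2 * (a ^- 2 * q.1 ^+ 2 + q.2 ^+ 2)).
  move=> pq cp pE; have /eqP := normal_param a0 cq cp pE.
  rewrite mulf_eq0 => /orP[/eqP t0|]; last by rewrite addr_eq0 => /eqP.
  by exfalso; apply: pq; rewrite pE t0 !mul0r !addr0; case: (phi a q).
have t12 : t1 = t2.
  by apply: (mulIf (lt0r_neq0 d0)); rewrite (tn0 p1 t1)// (tn0 p2 t2).
by apply: (phi_inj a0); rewrite t1E t2E t12.
Qed.

Lemma normal_chord_ex (R : realType) (a : R) (q : R * R) :
  a != 0 -> circle q -> exists p, normal_chord a q p.
Proof.
move=> a0 cq.
have k0 : 0 < a ^- 2 by rewrite invr_gt0 exprn_even_gt0.
have d0 := normal_denom_gt0 k0 cq.
set k := a ^- 2 in k0 d0; set d := _ + _ in d0.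
pose e := k * q.1 ^+ 2 + q.2 ^+ 2.
have e0 : 0 < e.
  have := @normal_denom_gt0 _ (Num.sqrt k) q; rewrite sqr_sqrtr ?ltW//.
  by rewrite sqrtr_gt0; apply.
have [t tE] : exists t, t * d + 2 * e = 0.
  by exists (- (2 * e) / d); rewrite divfK ?lt0r_neq0// addNr.
have t0 : t != 0.
  by apply/negP => /eqP t0; move: tE; rewrite t0 mul0r add0r; lra.
pose p := (q.1 + t * q.1 * k, q.2 + t * q.2).
have cp : circle p.
  rewrite /circle /=; move: cq; rewrite /circle /= => cq.
  have : t * (t * d + 2 * e) = 0 by rewrite tE mulr0.
  by rewrite /d /e => h; rewrite -[RHS]addr0 -[in RHS]cq -h; ring.
have pE : phi a p = ((phi a q).1 + t * ((phi a q).1 / a ^+ 2),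
                     (phi a q).2 + t * (phi a q).2).
  by rewrite /phi /p /= -/k; congr pair; ring.
exists p; split => //; first exact: ellipse_phi.
  move=> /(phi_inj a0) pq.
  have [q1 q2] : t * q.1 * k = 0 /\ t * q.2 = 0.
    have [] : p.1 = q.1 /\ p.2 = q.2 by rewrite pq.
    by rewrite /p /= => h1 h2; split; lra.
  have q10 : q.1 = 0.
    by apply/eqP; move/eqP: q1; rewrite !mulf_eq0 (negbTE t0) (gt_eqF k0) orbF.
  have q20 : q.2 = 0 by apply/eqP; move/eqP: q2; rewrite mulf_eq0 (negbTE t0).
  move: cq; rewrite /circle /= q10 q20 expr0n /= addr0.
  by move=> /esym/eqP; rewrite oner_eq0.
by exists t.
Qed.

Lemma h_spec (R : realType) (a : R) (q : R * R) :
  a != 0 -> circle q -> normal_chord a q (h a q).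
Proof. by move=> a0 cq; apply: getPex; exact: normal_chord_ex. Qed.

Lemma h_eq (R : realType) (a : R) (q p : R * R) :
  a != 0 -> circle q -> normal_chord a q p -> h a q = p.
Proof.
by move=> a0 cq np; apply: normal_chord_unique np => //; exact: h_spec.
Qed.

(** The tangent at [phi a (pt y)] is orthogonal to the chord. *)
Lemma normal_line_slope (R : realType) (a x y : R) : a != 0 ->
  normal_line a (phi a (pt y)) (phi a (pt x)) <-> slope a x y = 0.
Proof.
move=> a0; rewrite /normal_line /phi /pt /slope /=; split.
  move=> [t [e1 e2]].
  have -> : sin x - sin y = t * sin y by lra.
  have -> : a ^+ 2 * (cos x - cos y) = a * (a * cos x - a * cos y) by ring.
  by rewrite e1; field.
move=> /eqP; rewrite subr_eq0 => /eqP sE.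
have [s0|s0] := eqVneq (sin y) 0.
  have c0 : cos y != 0.
    apply/negP => /eqP c0; have /eqP := cos2Dsin2 y.
    by rewrite c0 s0 expr0n addr0 eq_sym oner_eq0.
  exists (a ^+ 2 * (cos x - cos y) / cos y); congr pair.
    by field; rewrite a0 c0.
  move: sE; rewrite s0 !mulr0 => /esym/eqP; rewrite mulf_eq0 (negbTE c0) orbF.
  by rewrite subr0 => /eqP ->; rewrite oppr0 mulr0 addr0.
exists ((sin x - sin y) / sin y); congr pair; last by field.
have -> : (sin x - sin y) / sin y * (a * cos y / a ^+ 2) =
  ((sin x - sin y) * cos y) * (a / (sin y * a ^+ 2)) by field; rewrite a0 s0.
by rewrite -sE; field; rewrite a0 s0.
Qed.

(** By [slope_half] the slope is a multiple of [g], which changes sign between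
    the chord of zero width and the full turn.  Dividing the factor [sin w] out
    is needed because the slope itself vanishes at both ends. *)
Lemma slope_eq0_ex (R : realType) (a x : R) : 1 <= a ^+ 2 ->
  exists2 y, x < y < x + pi *+ 2 & slope a x y = 0.
Proof.
move=> a1; have p0 := pi_gt0 R.
pose g (w : R) := cos w * (a ^+ 2 * sin (x + w) ^+ 2 + cos (x + w) ^+ 2)
               + (a ^+ 2 - 1) * sin (x + w) * cos (x + w) * sin w.
have q0 u : 0 < a ^+ 2 * sin u ^+ 2 + cos u ^+ 2.
  have := cos2Dsin2 u; have : 0 <= (a ^+ 2 - 1) * sin u ^+ 2.
    by apply: mulr_ge0; [lra|exact: sqr_ge0].
  by lra.
have g0 : 0 < g 0 by rewrite /g cos0 sin0 mul1r mulr0 !addr0.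
have gpi : g pi < 0.
  by rewrite /g cospi sinpi mulr0 addr0 mulN1r oppr_lt0.
have [|||w] := @IVT R g 0 pi 0.
- exact: ltW.
- apply: continuous_subspaceT => w; rewrite /g.
  have Fc : cos (x + t) @[t --> w] --> cos (x + w).
    apply: continuous_cvg; first exact: continuous_cos.
    by apply: cvgD; [exact: cvg_cst|exact: cvg_id].
  have Fs : sin (x + t) @[t --> w] --> sin (x + w).
    apply: continuous_cvg; first exact: continuous_sin.
    by apply: cvgD; [exact: cvg_cst|exact: cvg_id].
  apply: cvgD.
    apply: cvgM; first exact: continuous_cos.
    by rewrite !expr2; apply: cvgD; [apply: cvgM; [exact: cvg_cst|]|]; apply: cvgM.
  apply: cvgM; last exact: continuous_sin.
  by apply: cvgM => //; apply: cvgM => //; exact: cvg_cst.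
- by rewrite ge_min le_max (ltW g0) (ltW gpi) orbT.
rewrite in_itv /= => /andP[w0 wpi] gw.
have w0' : w != 0 by apply/negP => /eqP wE; move: g0; rewrite -[X in g X]wE gw ltxx.
have wpi' : w != pi by apply/negP => /eqP wE; move: gpi; rewrite -[X in g X]wE gw ltxx.
have w1 : 0 < w by rewrite lt0r w0' w0.
have w2 : w < pi by rewrite lt_neqAle wpi' wpi.
exists (x + w + w); first by lra.
by rewrite -{1}(addrK w x) slope_half -/(g w) gw mulr0.
Qed.

(** Whichever preimage of [pt x] under [h a] is picked, the chord from [pt x] to it
    is normal to the ellipse at its end, hence has length at least 2. *)
Lemma h_inv_pt (R : realType) (a x : R) : 1 <= a ^+ 2 -> a != 0 ->
  exists y, [/\ x < y < x + 2 * pi, slope a x y = 0 & h_inv a (pt x) = pt y].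
Proof.
move=> a1 a0; have [y0 hy0 sy0] := slope_eq0_ex x a1.
have [cq hq] : circle (h_inv a (pt x)) /\ h a (h_inv a (pt x)) = pt x.
  apply: (@getPex _ [set q : R * R | circle q /\ h a q = pt x]).
  exists (pt y0); split; first exact: circle_pt.
  apply: h_eq => //; first exact: circle_pt.
  split; [exact: circle_pt|by apply: ellipse_phi => //; exact: circle_pt| |].
    by move=> /(phi_inj a0) ptE; have := pt_inj _ ptE; lra.
  exact/normal_line_slope.
have [t ht qE] := pt_surj x cq.
have := h_spec a0 cq; rewrite hq qE => -[_ _ xy /(normal_line_slope _ _ a0) s0].
exists (x + t); split => //.
suff t0 : t != 0.
  by have : 0 < t; [rewrite lt0r t0; case/andP: ht|lra].
by apply/negP => /eqP t0; apply: xy; rewrite t0 addr0.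
Qed.

(** On the arc from [x] to its preimage [y] under [h], the points at distance at
    most [r] are those up to [step a r x].  If the arc is longer than half a
    turn, its final part is read backwards: there the chords are longer than the
    last one as soon as they are shorter than 2, and the last one is at least
    2. *)
Lemma F_pt (R : realType) (a r x : R) :
  1 <= a ^+ 2 <= 2 -> 0 < r < 2 -> F (pt x) r a = pt (step a r x).
Proof.
move=> ha hr; have /andP[a1 a2] := ha; have p0 := pi_gt0 R.
have a0 : a != 0.
  by apply/negP => /eqP a0; move: a1; rewrite a0 expr0n /=; lra.
have r0 : 0 < r by case/andP: hr.
have r4 := sqr_lt4 hr.
have [y [hy sy hE]] := h_inv_pt x a1 a0.
have Dy : 4 <= chord2 a x y by apply: slope_eq0_chord2 => //; lra.
have /andP[xs spi] := step_bounds x ha hr; have [_ sE] := stepP x ha hr.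
have sley : step a r x <= y.
  have [ypi|] := leP y (x + pi); last by lra.
  by apply/ltW; rewrite step_lt//; lra.
have arc z : x <= z <= y -> chord2 a x z <= r ^+ 2 -> z <= step a r x.
  move=> /andP[xz zy] Dz; rewrite leNgt; apply/negP => sz.
  have [zpi|piz] := leP z (x + pi).
    by move: sz; rewrite step_lt ?xz// ltNge Dz.
  (* Beyond the antipode the arc is read backwards, ending at [x + 2 * pi]. *)
  have : chord2 a (- x) (pi *+ 2 - y) <= chord2 a (- x) (pi *+ 2 - z).
    have [->//|yz] := eqVneq y z.
    have {}zy : z < y by rewrite lt_neqAle eq_sym yz.
    by apply/ltW/chord2_homo; rewrite ?chord2_flip//; lra.
  by rewrite !chord2_flip; lra.
rewrite /F; apply: get_unique => /=.
  split; first split.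
  - exists (step a r x - x) => /=; last by rewrite cw_rot_pt subrKC.
    by rewrite hE cw_dist_pt; lra.
  - by rewrite dist2_phi_le// sE.
  - move=> q [_]; rewrite [X in _ -> _ <= X]dist2_phi sE sqrtr_sqr gtr0_norm//.
move=> q [[[t /= ht <-]]]; rewrite hE cw_dist_pt in ht; last by lra.
rewrite cw_rot_pt dist2_phi_le// => Dt /(_ (pt (step a r x))) max.
have tle : x + t <= step a r x by apply: arc => //; lra.
congr pt; apply/eqP; rewrite eq_le tle leNgt lt_step//; last by lra.
rewrite -leNgt -ler_sqrt ?chord2_ge0// -dist2_phi sqrtr_sqr gtr0_norm//.
have -> : r = dist2 (phi a (pt x)) (phi a (pt (step a r x))).
  by rewrite dist2_phi sE sqrtr_sqr gtr0_norm.
apply: max; split; last by rewrite dist2_phi_le// sE.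
exists (step a r x - x) => /=; last by rewrite cw_rot_pt subrKC.
by rewrite hE cw_dist_pt; lra.
Qed.

Lemma F_iter_pt (R : realType) (a r x : R) (n : nat) :
  1 <= a ^+ 2 <= 2 -> 0 < r < 2 ->
  Fiter n (pt x) r a = pt (iter n (step a r) x).
Proof.
by move=> ha hr; rewrite /Fiter; elim: n => //= n ->; rewrite F_pt.
Qed.

Lemma stepDintpi (R : realType) (a r x : R) (m : int) :
  1 <= a ^+ 2 <= 2 -> 0 < r < 2 ->
  step a r (x + m%:~R * pi) = step a r x + m%:~R * pi.
Proof.
move=> ha hr.
have natD (k : nat) y : step a r (y + k%:R * pi) = step a r y + k%:R * pi.
  elim: k => [|k IHk]; first by rewrite mulr0n mul0r !addr0.
  by rewrite [k.+1%:R]mulrSr mulrDl mul1r addrA stepDpi// IHk -addrA.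
case: m => k; first exact: natD.
rewrite NegzE rmorphN /= mulNr -{2}(subrK (k.+1%:R * pi) x).
by rewrite natD addrK.
Qed.

Lemma iter_stepDintpi (R : realType) (a r x : R) (m : int) (n : nat) :
  1 <= a ^+ 2 <= 2 -> 0 < r < 2 ->
  iter n (step a r) (x + m%:~R * pi) = iter n (step a r) x + m%:~R * pi.
Proof. by move=> ha hr; elim: n => //= n ->; rewrite stepDintpi. Qed.

Lemma sigmaDintpi (R : realType) (a x : R) (m : int) :
  1 <= a ^+ 2 <= 2 -> sigma a (x + m%:~R * pi) = sigma a x.
Proof.
move=> ha; have [hs sE] := sigmaP x ha; apply: sigma_unique => //.
by rewrite iter_stepDintpi// sE addrAC.
Qed.

Lemma iter_step_opp (R : realType) (a r x : R) (n : nat) :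
  1 <= a ^+ 2 <= 2 -> 0 < r < 2 ->
  iter n (step a r) (- iter n (step a r) x) = - x.
Proof.
move=> ha hr; elim: n => //= n IHn.
by rewrite -iterS iterSr step_opp.
Qed.

Lemma step_inj (R : realType) (a r : R) :
  1 <= a ^+ 2 <= 2 -> 0 < r < 2 -> injective (step a r).
Proof.
move=> ha hr x y xy.
by apply: oppr_inj; rewrite -(step_opp x ha hr) -(step_opp y ha hr) xy.
Qed.

Lemma iter_step_inj (R : realType) (a r : R) (n : nat) :
  1 <= a ^+ 2 <= 2 -> 0 < r < 2 -> injective (iter n (step a r)).
Proof.
by move=> ha hr; elim: n => // n IHn x y /= /(step_inj ha hr) /IHn.
Qed.

(** The sum telescopes to five steps starting at [step a r x]; since [step a r] is
    increasing and commutes with the translation by [4 * pi], this first step can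
    be cancelled. *)
Lemma side_length_pt (R : realType) (a x : R) :
  1 <= a ^+ 2 <= 2 -> side_length a (pt x) = sigma a x.
Proof.
move=> ha; have [hs _] := sigmaP x ha; rewrite /side_length.
set A := [set r | _].
have AE r : A r <-> sigma a x <= r < 2.
  have sumE : 0 < r < 2 ->
      \sum_(1 <= i < 6) cw_dist (Fiter i (pt x) r a) (Fiter i.+1 (pt x) r a)
      = step a r (iter 5 (step a r) x) - step a r x.
    move=> hr; rewrite (eq_bigr (fun i : nat =>
        iter i.+1 (step a r) x - iter i (step a r) x)) => [|i _].
      by rewrite telescope_sumr.
    rewrite !F_iter_pt// iterS cw_dist_pt//.
    by have := step_bounds (iter i (step a r) x) ha hr; have := pi_gt0 R; lra.
  have leE : 0 < r < 2 ->
      (4 * pi <= step a r (iter 5 (step a r) x) - step a r x) = (sigma a x <= r).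
    move=> hr; rewrite lerBrDl leNgt [RHS]leNgt lt_sigma//; congr (~~ _).
    have -> : step a r x + 4 * pi = step a r (x + 4 * pi).
      by rewrite (@stepDintpi R a r x 4).
    by apply: leW_mono; apply: le_mono; exact: step_homo.
  split=> [[hr]|/andP[sr r2]]; first by rewrite sumE// leE// => ->; case/andP: hr.
  have hr : 0 < r < 2 by lra.
  by split => //; rewrite sumE// leE.
apply/eqP; rewrite eq_le; apply/andP; split.
  apply: ge_inf; last by apply/AE; rewrite lexx; case/andP: hs.
  by exists 0 => r /AE; lra.
apply: lb_le_inf; first by exists (sigma a x); apply/AE; rewrite lexx; case/andP: hs.
by move=> r /AE /andP[].
Qed.

(** * Level sets of the side-length function *)
Lemma iter_translation (R : realType) (a r x : R) (n k : nat) (l : int) :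
  1 <= a ^+ 2 <= 2 -> 0 < r < 2 ->
  iter n (step a r) x = x + l%:~R * pi ->
  iter (k * n) (step a r) x = x + (k%:Z * l)%:~R * pi.
Proof.
move=> ha hr xn; elim: k => [|k IHk]; first by rewrite mul0r mul0r addr0.
rewrite mulSn iterD IHk iter_stepDintpi// xn -addrA -mulrDl -intrD.
by congr (_ + _%:~R * _); lia.
Qed.

(** The [5 * d] steps from [x] are [d] times five steps, and also five times [d]
    steps. *)
Lemma orbit_rotation (R : realType) (a r x : R) (d : nat) (m : int) :
  1 <= a ^+ 2 <= 2 -> 0 < r < 2 ->
  iter 5 (step a r) x = x + 4 * pi ->
  iter d (step a r) x = x + m%:~R * pi -> 4 * d%:Z = 5 * m.
Proof.
move=> ha hr x5 xd.
have := @iter_translation R a r x 5 d 4 ha hr x5.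
rewrite mulnC (iter_translation 5 ha hr xd) => /addrI.
by move=> /(mulIf (lt0r_neq0 (pi_gt0 R))) /intr_inj; lia.
Qed.

Lemma pt_eq (R : realType) (x y : R) :
  pt x = pt y -> exists m : int, y = x + (2 * m)%:~R * pi.
Proof.
move=> xy; have p0 : 0 < 2 * pi :> R by have := pi_gt0 R; lra.
pose m := Num.floor ((y - x) / (2 * pi)); exists m.
have := floor_itv ((y - x) / (2 * pi)); rewrite -/m.
rewrite ler_pdivlMr// ltr_pdivrMr// intrD mulrDl mul1r => hm.
have ptD : pt (x + (2 * m)%:~R * pi) = pt x.
  have natD (k : nat) z : pt (z + (2 * k%:Z)%:~R * pi) = pt z :> R * R.
    elim: k => [|k IHk]; first by rewrite mulr0 mul0r addr0.
    rewrite -[RHS]IHk -[RHS]ptD2pi; congr pt.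
    by rewrite -natr1 !rmorphM rmorphD /=; ring.
  case: (m) => k; first exact: natD.
  by rewrite -(natD k.+1) NegzE; congr pt; rewrite mulrN rmorphN /= mulNr subrK.
apply/esym; apply: pt_inj; last by rewrite ptD.
by rewrite intrM; lra.
Qed.

Lemma odd_half_div4 (n m : nat) :
  (n %/ 4 = m %/ 4)%N -> odd (n %/ 2)%N = odd (m %/ 2)%N -> odd n = odd m -> n = m.
Proof. by lia. Qed.

(** The twenty points are the five first iterates of [y1] and [y2] and their
    antipodes.  Two of them can only coincide if an iterate of one of the two
    points is a translate of the other, which is excluded, or of itself, which
    [orbit_rotation] prevents for fewer than five steps. *)
Lemma card_two_orbits (R : realType) (a r y1 y2 : R) (A : set (R * R)) :
  1 <= a ^+ 2 <= 2 -> 0 < r < 2 ->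
  iter 5 (step a r) y1 = y1 + 4 * pi -> iter 5 (step a r) y2 = y2 + 4 * pi ->
  (forall (d : nat) (m : int), iter d (step a r) y1 <> y2 + m%:~R * pi) ->
  (forall z, iter 5 (step a r) z = z + 4 * pi -> A (pt z)) ->
  `I_20 #<= A.
Proof.
move=> ha hr y1P y2P y12 AP.
have y21 d m : iter d (step a r) y2 <> y1 + m%:~R * pi.
  move=> y2d; apply: (y12 (4 * d)%N (4 * d%:Z - m)).
  have := @iter_translation R a r y2 5 d 4 ha hr y2P.
  have -> : (d * 5 = 4 * d + d)%N by lia.
  rewrite iterD y2d iter_stepDintpi// => E; apply: (addIr (m%:~R * pi)).
  rewrite E -addrA -mulrDl -intrD subrK.
  by congr (_ + _%:~R * _); lia.
pose y (b : bool) := if b then y2 else y1.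
have yP b : iter 5 (step a r) (y b) = y b + 4 * pi by case: b.
pose z (n : nat) :=
  iter (n %/ 4)%N (step a r) (y (odd (n %/ 2)%N)) + (nat_of_bool (odd n))%:Z%:~R * pi.
suff zinj : {in `I_20 &, injective (fun n => pt (z n))}.
  rewrite -(card_le_eql (inj_card_eq zinj)); apply: subset_card_le => _ [n _ <-].
  apply: AP; rewrite /z iter_stepDintpi// -iterD addnC iterD yP.
  by rewrite (@iter_stepDintpi R a r _ 4)// addrAC.
move=> n n'; rewrite !inE /= => n20 n'20 /pt_eq[m].
rewrite /z; set i := (n %/ 4)%N; set i' := (n' %/ 4)%N.
set b := odd (n %/ 2)%N; set b' := odd (n' %/ 2)%N.
set j := (odd n : nat); set j' := (odd n' : nat) => zE.
have iE : iter i' (step a r) (y b') =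
          iter i (step a r) (y b) + (j%:Z + 2 * m - j'%:Z)%:~R * pi.
  apply: (addIr (j'%:Z%:~R * pi)); rewrite zE !rmorphB !rmorphD /=; ring.
have i5 : (i < 5)%N by lia.
have i5' : (i' < 5)%N by lia.
have transport k c c' (M : int) : (k <= 5)%N ->
    iter k (step a r) (y c') = iter i (step a r) (y c) + M%:~R * pi ->
    iter (5 - k + i) (step a r) (y c) = y c' + (4 - M)%:~R * pi.
  move=> k5 kE; rewrite iterD; apply: (addIr (M%:~R * pi)).
  rewrite -iter_stepDintpi// -kE -iterD subnK// yP rmorphB /=; ring.
have bb' : b = b'.
  have kE := transport i' b b' _ (ltnW i5') iE.
  by move: kE; case: (b) (b') => [] [] // kE; exfalso; [apply: y21 kE|apply: y12 kE].
rewrite -bb' in iE.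
have := orbit_rotation ha hr (yP b) (transport i' b b _ (ltnW i5') iE).
have [j1 j1'] : (j <= 1)%N /\ (j' <= 1)%N by rewrite /j /j'; split; exact: leq_b1.
move=> rot; have ii' : i = i' by lia.
have jj' : j = j' by lia.
apply: odd_half_div4 => //; move: jj'; rewrite /j /j'.
by case: (odd n) (odd n') => [] [].
Qed.

(** If [- c] is not, up to a translation, an iterate of [c], then both together
    give twenty points.  Otherwise, five steps being a translation, [- c] is
    also reached up to a translation after an even number [l + l] of steps;
    halfway, the iterate [e] of [c] satisfies [e = - e + k * pi], so it lies on
    an axis and [0] and [pi / 2] are in the level set. *)
Lemma card_level_set (R : realType) (a c : R) (A : set (R * R)) :
  1 <= a ^+ 2 <= 2 -> sigma a 0 = sigma a (pi / 2) ->
  (forall z, sigma a z = sigma a c -> A (pt z)) -> `I_20 #<= A.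
Proof.
move=> ha axisE AP; have [] := sigmaP c ha; move rE : (sigma a c) => r hr cP.
have {}AP z : iter 5 (step a r) z = z + 4 * pi -> A (pt z).
  by move=> zP; apply: AP; rewrite rE; exact: sigma_unique.
have NcP : iter 5 (step a r) (- c) = - c + 4 * pi.
  have := iter_step_opp c 5 ha hr; rewrite cP opprD.
  rewrite -mulNr (@iter_stepDintpi R a r (- c) (- 4%:Z) 5 ha hr) => E.
  by apply: (addIr ((- 4%:Z)%:~R * pi)); rewrite E rmorphN /=; ring.
have [[d [m cd]]|sep] := pselect (exists d (m : int),
    iter d (step a r) c = - c + m%:~R * pi); last first.
  by apply: (card_two_orbits ha hr cP NcP) => // d m cd; apply: sep; exists d, m.
have [l [k cl]] : exists l (k : int), iter (l + l) (step a r) c = - c + k%:~R * pi.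
  case dE : (odd d).
    exists (d + 5)./2, (m + 4); rewrite addnn halfK oddD dE subn0 addnC iterD cd.
    by rewrite iter_stepDintpi// NcP rmorphD /=; ring.
  by exists d./2, m; rewrite addnn halfK dE subn0 cd.
pose e := iter l (step a r) c.
have eE : e = k%:~R * (pi / 2).
  have : e = - e + k%:~R * pi.
    apply: (@iter_step_inj R a r l ha hr).
    by rewrite iter_stepDintpi// iter_step_opp// -cl iterD.
  by lra.
have eP : iter 5 (step a r) e = e + 4 * pi.
  by rewrite /e -iterD addnC iterD cP (@iter_stepDintpi R a r c 4).
have axisP : sigma a 0 = r.
  rewrite -(sigma_unique ha hr eP) eE.
  have [q [->|->]] : exists q : int, k = 2 * q \/ k = 2 * q + 1.
    by exists (k %/ 2)%Z; lia.
  - have -> : (2 * q)%:~R * (pi / 2) = 0 + q%:~R * pi :> R.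
      by rewrite rmorphM /=; field.
    by rewrite sigmaDintpi.
  - have -> : (2 * q + 1)%:~R * (pi / 2) = pi / 2 + q%:~R * pi :> R.
      by rewrite rmorphD rmorphM /=; field.
    by rewrite sigmaDintpi// axisE.
have P0 : iter 5 (step a r) 0 = 0 + 4 * pi by rewrite -axisP; have [] := sigmaP 0 ha.
have Ph : iter 5 (step a r) (pi / 2) = pi / 2 + 4 * pi.
  by rewrite -axisP axisE; have [] := sigmaP (pi / 2) ha.
(* The two axes give different stars: otherwise, by symmetry, an iterate would
   translate [0] by an odd multiple of [pi]. *)
apply: (card_two_orbits ha hr P0 Ph) => // n j nE.
have hE : iter n (step a r) (pi / 2) = (j + 1)%:~R * pi.
  have := iter_step_opp 0 n ha hr; rewrite nE oppr0 => E.
  have -> : pi / 2 = - (pi / 2 + j%:~R * pi) + (j + 1)%:~R * pi :> R.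
    by rewrite rmorphD /=; field.
  by rewrite iter_stepDintpi// E add0r.
have : iter (n + n) (step a r) 0 = 0 + (2 * j + 1)%:~R * pi.
  rewrite iterD nE iter_stepDintpi// hE add0r -mulrDl -intrD.
  by congr (_%:~R * _); lia.
by move=> /(orbit_rotation ha hr P0); lia.
Qed.

(** Every point of the level set of a global extremum is a local extremum. *)
Lemma side_length_extrema (R : realType) (a : R) :
  1 < a -> a ^+ 2 < 2 -> sigma a 0 = sigma a (pi / 2) ->
  `I_20 #<= local_minima circle (side_length a) /\
  `I_20 #<= local_maxima circle (side_length a).
Proof.
move=> a1 a2 axisE.
have ha : 1 <= a ^+ 2 <= 2 by rewrite exprn_ege1 ?(ltW a2)// ltW.
have p0 : 0 <= 2 * pi :> R by have := pi_gt0 R; lra.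
have cont : {within `[0, 2 * pi], continuous (sigma a)}.
  apply: continuous_subspaceT => x.
  apply: (@sigma_cvg R R (nbhs x) _ (fun=> a) id) => //; last exact: cvg_cst.
  by near=> t.
split.
- have [c _ cmin] := EVT_min p0 cont.
  apply: (card_level_set (c := c) ha axisE) => z zc; split; first exact: circle_pt.
  rewrite near_withinE; apply: filterE => q cq; have [t ht ->] := pt_surj0 cq.
  by rewrite !side_length_pt// zc; apply: cmin; rewrite in_itv /=; lra.
- have [c _ cmax] := EVT_max p0 cont.
  apply: (card_level_set (c := c) ha axisE) => z zc; split; first exact: circle_pt.
  rewrite near_withinE; apply: filterE => q cq; have [t ht ->] := pt_surj0 cq.
  by rewrite !side_length_pt// zc; apply: cmax; rewrite in_itv /=; lra.
Unshelve. all: by end_near. Qed.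

(** * Certified bounds for symmetric stars *)

(** A polygon with sides shorter than [r] is overtaken by the steps of length
    [r]. *)
Lemma iter5_step_gt (R : realType) (a r y0 y1 y2 y3 y4 y5 : R) :
  1 <= a ^+ 2 <= 2 -> 0 < r < 2 ->
  y0 <= y1 <= y0 + pi -> y1 <= y2 <= y1 + pi -> y2 <= y3 <= y2 + pi ->
  y3 <= y4 <= y3 + pi -> y4 <= y5 <= y4 + pi ->
  chord2 a y0 y1 < r ^+ 2 -> chord2 a y1 y2 < r ^+ 2 ->
  chord2 a y2 y3 < r ^+ 2 -> chord2 a y3 y4 < r ^+ 2 ->
  chord2 a y4 y5 < r ^+ 2 ->
  y5 < iter 5 (step a r) y0.
Proof.
move=> ha hr h1 h2 h3 h4 h5; rewrite -!lt_step// => d1 d2 d3 d4 d5.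
have next y y' z : z < step a r y -> y < y' -> z < step a r y'.
  by move=> zy yy'; apply: lt_trans zy _; exact: step_homo.
rewrite /=; apply: (next _ _ _ d5); apply: (next _ _ _ d4).
by apply: (next _ _ _ d3); apply: (next _ _ _ d2).
Qed.

Lemma iter5_step_lt (R : realType) (a r y0 y1 y2 y3 y4 y5 : R) :
  1 <= a ^+ 2 <= 2 -> 0 < r < 2 ->
  y0 <= y1 <= y0 + pi -> y1 <= y2 <= y1 + pi -> y2 <= y3 <= y2 + pi ->
  y3 <= y4 <= y3 + pi -> y4 <= y5 <= y4 + pi ->
  r ^+ 2 < chord2 a y0 y1 -> r ^+ 2 < chord2 a y1 y2 ->
  r ^+ 2 < chord2 a y2 y3 -> r ^+ 2 < chord2 a y3 y4 ->
  r ^+ 2 < chord2 a y4 y5 ->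
  iter 5 (step a r) y0 < y5.
Proof.
move=> ha hr h1 h2 h3 h4 h5; rewrite -!step_lt// => d1 d2 d3 d4 d5.
have next y y' z : step a r y < z -> y' < y -> step a r y' < z.
  by move=> zy yy'; apply: lt_trans zy; exact: step_homo.
rewrite /=; apply: (next _ _ _ d5); apply: (next _ _ _ d4).
by apply: (next _ _ _ d3); apply: (next _ _ _ d2).
Qed.

Lemma upper_half_circle_angle (R : realType) (c s : R) :
  c ^+ 2 + s ^+ 2 = 1 -> 0 <= s ->
  exists2 u, 0 <= u <= pi & cos u = c /\ sin u = s.
Proof.
move=> cs s0; have c1 : -1 <= c <= 1 by have := sqr_ge0 s; nra.
exists (acos c); first by rewrite acos_ge0//= acos_lepi.
rewrite acosK ?in_itv//; split => //; rewrite sin_acos//.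
have -> : 1 - c ^+ 2 = s ^+ 2 by lra.
by rewrite sqrtr_sqr ger0_norm.
Qed.

(** The two axes differ only by the roles of the coordinates: angles being
    measured from the end [x0] of one axis, the squared distance has the weight
    [k] along that axis and [l] across it. *)
Definition axis_form {R : realType} (a x0 k l : R) :=
  forall s t, chord2 a (x0 + s) (x0 + t) =
    k * (cos s - cos t) ^+ 2 + l * (sin s - sin t) ^+ 2.

Lemma axis_form0 (R : realType) (a : R) : axis_form a 0 (a ^+ 2) 1.
Proof. by move=> s t; rewrite /chord2 !add0r mul1r. Qed.

Lemma axis_form_pihalf (R : realType) (a : R) : axis_form a (pi / 2) 1 (a ^+ 2).
Proof.
by move=> s t; rewrite /chord2 ![pi / 2 + _]addrC !cosDpihalf !sinDpihalf; ring.
Qed.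

(** A star that is symmetric about its axis has its vertices at the angles [0],
    [u], [- v], [v] and [- u].  The bounds on [u], [v] and [u + v]
    say that its consecutive vertices are at most half a turn apart. *)
Lemma symmetric_star_angles (R : realType) (c1 s1 c2 s2 : R) :
  c1 ^+ 2 + s1 ^+ 2 = 1 -> 0 <= s1 -> c2 ^+ 2 + s2 ^+ 2 = 1 -> 0 <= s2 ->
  0 <= c2 -> c1 + c2 <= 0 ->
  exists u v, [/\ 0 <= u <= pi, 0 <= v <= pi / 2, pi <= u + v,
    cos u = c1 /\ sin u = s1 & cos v = c2 /\ sin v = s2].
Proof.
move=> cs1 s10 cs2 s20 c20 c12; have p0 := pi_gt0 R.
have [u hu [cu su]] := upper_half_circle_angle cs1 s10.
have [v hv [cv sv]] := upper_half_circle_angle cs2 s20.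
have uv : pi <= u + v.
  rewrite leNgt; apply/negP => uv.
  have : cos (pi - v) < cos u by rewrite ltr_cos ?in_itv/=; lra.
  by rewrite addrC cosDpi cosN cu cv; lra.
exists u, v; split => //.
suff : v <= pi / 2 by lra.
rewrite leNgt; apply/negP => vp.
have : cos v < cos (pi / 2) by rewrite ltr_cos ?in_itv/=; lra.
by rewrite cos_pihalf cv ltNge c20.
Qed.

(** In the order of the steps, the lifted vertices are [0], [u],
    [- v + 2 * pi], [v + 2 * pi], [- u + 4 * pi] and [4 * pi].  The symmetry leaves
    three different sides. *)
Lemma sigma_lt_star (R : realType) (a r x0 k l c1 s1 c2 s2 : R) :
  1 <= a ^+ 2 <= 2 -> 0 < r < 2 -> axis_form a x0 k l ->
  c1 ^+ 2 + s1 ^+ 2 = 1 -> 0 <= s1 -> c2 ^+ 2 + s2 ^+ 2 = 1 -> 0 <= s2 ->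
  0 <= c2 -> c1 + c2 <= 0 ->
  k * (1 - c1) ^+ 2 + l * s1 ^+ 2 < r ^+ 2 ->
  k * (c1 - c2) ^+ 2 + l * (s1 + s2) ^+ 2 < r ^+ 2 ->
  4 * l * s2 ^+ 2 < r ^+ 2 ->
  sigma a x0 < r.
Proof.
move=> ha hr form cs1 s10 cs2 s20 c20 c12 d1 d2 d3.
have [u [v [hu hv uv [cu su] [cv sv]]]] :=
  symmetric_star_angles cs1 s10 cs2 s20 c20 c12.
rewrite sigma_lt//.
have := @iter5_step_gt R a r (x0 + 0) (x0 + u) (x0 + (- v + pi *+ 2))
  (x0 + (v + pi *+ 2)) (x0 + (- u + pi *+ 2 + pi *+ 2))
  (x0 + (0 + pi *+ 2 + pi *+ 2)) ha hr.
rewrite !form !cosD2pi !sinD2pi !cosN !sinN cos0 sin0 cu su cv sv.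
have -> : x0 + (0 + pi *+ 2 + pi *+ 2) = x0 + 4 * pi by ring.
by rewrite !addr0; apply; lra.
Qed.

Lemma lt_sigma_star (R : realType) (a r x0 k l c1 s1 c2 s2 : R) :
  1 <= a ^+ 2 <= 2 -> 0 < r < 2 -> axis_form a x0 k l ->
  c1 ^+ 2 + s1 ^+ 2 = 1 -> 0 <= s1 -> c2 ^+ 2 + s2 ^+ 2 = 1 -> 0 <= s2 ->
  0 <= c2 -> c1 + c2 <= 0 ->
  r ^+ 2 < k * (1 - c1) ^+ 2 + l * s1 ^+ 2 ->
  r ^+ 2 < k * (c1 - c2) ^+ 2 + l * (s1 + s2) ^+ 2 ->
  r ^+ 2 < 4 * l * s2 ^+ 2 ->
  r < sigma a x0.
Proof.
move=> ha hr form cs1 s10 cs2 s20 c20 c12 d1 d2 d3.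
have [u [v [hu hv uv [cu su] [cv sv]]]] :=
  symmetric_star_angles cs1 s10 cs2 s20 c20 c12.
rewrite lt_sigma//.
have := @iter5_step_lt R a r (x0 + 0) (x0 + u) (x0 + (- v + pi *+ 2))
  (x0 + (v + pi *+ 2)) (x0 + (- u + pi *+ 2 + pi *+ 2))
  (x0 + (0 + pi *+ 2 + pi *+ 2)) ha hr.
rewrite !form !cosD2pi !sinD2pi !cosN !sinN cos0 sin0 cu su cv sv.
have -> : x0 + (0 + pi *+ 2 + pi *+ 2) = x0 + 4 * pi by ring.
by rewrite !addr0; apply; lra.
Qed.

(** Binary integers embedded in a ring.  The certificates involve integers of
    some sixty digits, whose signs are computed in binary and then carried to
    the reals. *)
Definition zr {R : pzRingType} (z : Z) : R := (int_of_Z z)%:~R.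
HB.instance Definition _ (R : pzRingType) :=
  GRing.RMorphism.copy (@zr R) (intmul 1 \o int_of_Z).

Lemma zr_lt (R : realDomainType) (x y : Z) : x < y -> zr x < zr y :> R.
Proof. by move=> xy; rewrite -subr_gt0 -rmorphB /zr ltr0z; lia. Qed.

Lemma zr_le (R : realDomainType) (x y : Z) : x <= y -> zr x <= zr y :> R.
Proof. by move=> xy; rewrite -subr_ge0 -rmorphB /zr ler0z; lia. Qed.

Lemma zr_gt0 (R : realDomainType) (z : Z) : 0 < z -> 0 < zr z :> R.
Proof. by move=> z0; rewrite -(rmorph0 (@zr R)); exact: zr_lt. Qed.

Lemma zr_nat (R : pzRingType) (n : nat) (z : Z) :
  z = Z.of_nat n -> n%:R = zr z :> R.
Proof. by move=> ->; rewrite /zr pmulrn; congr (_ *~ _); lia. Qed.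

Lemma zrD (R : pzRingType) (x y : Z) : zr (x + y) = zr x + zr y :> R.
Proof. exact: (rmorphD zr). Qed.

Lemma zrM (R : pzRingType) (x y : Z) : zr (x * y) = zr x * zr y :> R.
Proof. exact: (rmorphM zr). Qed.

Lemma zrX (R : pzRingType) (x : Z) (n : nat) : zr (x ^+ n) = zr x ^+ n :> R.
Proof. exact: (rmorphXn zr). Qed.

Lemma zr_natr (R : pzRingType) (n : nat) : zr n%:R = n%:R :> R.
Proof. exact: (rmorph_nat zr). Qed.

(** For the half-angle tangents [p1 / q1] and [p2 / q2] of [u] and [v], the three
    slacks are the excess of the squared length [(m / d) ^+ 2] over the weighted
    squared sides from [0] to [u], from [u] to [- v] and from [- v] to [v],
    multiplied by a square that clears the denominators. *)
Definition slack_apex {T : comPzRingType} (A B m d p q : T) : T :=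
  (m * (p ^+ 2 + q ^+ 2)) ^+ 2
  - d ^+ 2 * (A * (2 * p ^+ 2) ^+ 2 + B * (2 * p * q) ^+ 2).

Definition slack_side {T : comPzRingType} (A B m d p1 q1 p2 q2 : T) : T :=
  (m * (p1 ^+ 2 + q1 ^+ 2) * (p2 ^+ 2 + q2 ^+ 2)) ^+ 2
  - d ^+ 2 * (A * ((q1 ^+ 2 - p1 ^+ 2) * (p2 ^+ 2 + q2 ^+ 2)
                   - (q2 ^+ 2 - p2 ^+ 2) * (p1 ^+ 2 + q1 ^+ 2)) ^+ 2
              + B * (2 * p1 * q1 * (p2 ^+ 2 + q2 ^+ 2)
                     + 2 * p2 * q2 * (p1 ^+ 2 + q1 ^+ 2)) ^+ 2).

Definition slack_base {T : comPzRingType} (B m d p q : T) : T :=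
  (m * (p ^+ 2 + q ^+ 2)) ^+ 2 - d ^+ 2 * (B * (4 * p * q) ^+ 2).

(** A positive multiple of [- (cos u + cos v)], hence nonnegative exactly when
    [pi <= u + v]. *)
Definition ordered_angles {T : comPzRingType} (p1 q1 p2 q2 : T) : T :=
  (p1 ^+ 2 - q1 ^+ 2) * (p2 ^+ 2 + q2 ^+ 2)
  - (q2 ^+ 2 - p2 ^+ 2) * (p1 ^+ 2 + q1 ^+ 2).

(** The weights are [(x / g) ^+ 2] along the axis and [(y / g) ^+ 2] across it.
    For [e = 1] all the sides are shorter than [n / d], for [e = - 1] they are all
    longer. *)
Definition star_certificate (e x y g n d p1 q1 p2 q2 : Z) : bool :=
  [&& [&& 0 < p1, 0 < q1, 0 < p2 & 0 < q2],
      p2 <= q2, 0 <= ordered_angles p1 q1 p2 q2,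
      0 < e * slack_apex (x ^+ 2) (y ^+ 2) (g * n) d p1 q1,
      0 < e * slack_side (x ^+ 2) (y ^+ 2) (g * n) d p1 q1 p2 q2
    & 0 < e * slack_base (y ^+ 2) (g * n) d p2 q2].

Lemma zr_ordered_angles (R : comPzRingType) (p1 q1 p2 q2 : Z) :
  zr (ordered_angles p1 q1 p2 q2) =
  ordered_angles (zr p1) (zr q1) (zr p2) (zr q2) :> R.
Proof.
by rewrite /ordered_angles !(rmorphB, rmorphD, rmorphM, rmorphXn).
Qed.

Lemma zr_slack_apex (R : comPzRingType) (A B m d p q : Z) :
  zr (slack_apex A B m d p q) =
  slack_apex (zr A) (zr B) (zr m) (zr d) (zr p) (zr q) :> R.
Proof.
by rewrite /slack_apex !(rmorphB, rmorphD, rmorphM, rmorphXn, rmorph_nat).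
Qed.

Lemma zr_slack_side (R : comPzRingType) (A B m d p1 q1 p2 q2 : Z) :
  zr (slack_side A B m d p1 q1 p2 q2) =
  slack_side (zr A) (zr B) (zr m) (zr d) (zr p1) (zr q1) (zr p2) (zr q2) :> R.
Proof.
by rewrite /slack_side !(rmorphB, rmorphD, rmorphM, rmorphXn, rmorph_nat).
Qed.

Lemma zr_slack_base (R : comPzRingType) (B m d p q : Z) :
  zr (slack_base B m d p q) =
  slack_base (zr B) (zr m) (zr d) (zr p) (zr q) :> R.
Proof.
by rewrite /slack_base !(rmorphB, rmorphD, rmorphM, rmorphXn, rmorph_nat).
Qed.

Lemma rational_angle (R : realFieldType) (p q : R) : 0 < q ->
  ((q ^+ 2 - p ^+ 2) / (p ^+ 2 + q ^+ 2)) ^+ 2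
  + (2 * p * q / (p ^+ 2 + q ^+ 2)) ^+ 2 = 1.
Proof.
move=> q0; have n0 : p ^+ 2 + q ^+ 2 != 0.
  by rewrite gt_eqF// ltr_wpDl ?sqr_ge0// exprn_gt0.
by field.
Qed.

Lemma star_certificate_sides (R : realType) (e x y g n d p1 q1 p2 q2 : Z) :
  star_certificate e x y g n d p1 q1 p2 q2 -> 0 < g -> 0 < d ->
  let k := (zr x / zr g) ^+ 2 in let l := (zr y / zr g) ^+ 2 in
  let r2 := (zr n / zr d) ^+ 2 in
  exists c1 s1 c2 s2 : R,
    [/\ c1 ^+ 2 + s1 ^+ 2 = 1 /\ 0 <= s1, c2 ^+ 2 + s2 ^+ 2 = 1 /\ 0 <= s2,
        0 <= c2 /\ c1 + c2 <= 0
      & [/\ 0 < zr e * (r2 - (k * (1 - c1) ^+ 2 + l * s1 ^+ 2)),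
            0 < zr e * (r2 - (k * (c1 - c2) ^+ 2 + l * (s1 + s2) ^+ 2))
          & 0 < zr e * (r2 - 4 * l * s2 ^+ 2)]].
Proof.
move=> /and5P[/and4P[/(zr_gt0 R) + /(zr_gt0 R) + /(zr_gt0 R) + /(zr_gt0 R) +]].
move=> + + + + /(zr_le R) + /(zr_le R) + /(zr_gt0 R) + /andP[/(zr_gt0 R) + /(zr_gt0 R) +].
rewrite (rmorph0 zr) zr_ordered_angles !zrM.
rewrite zr_slack_apex zr_slack_side zr_slack_base !zrX !zrM.
move: (zr e) (zr x) (zr y) (zr n) (zr p1) (zr q1) (zr p2) (zr q2) => {e x y n}.
move=> e x y n {}p1 {}q1 {}p2 {}q2 p10 q10 p20 q20 pq2 ord apex side base.
move=> /(zr_gt0 R) + /(zr_gt0 R); move: (zr g) (zr d) apex side base.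
move=> {}g {}d apex side base g0 d0.
have n1 : 0 < p1 ^+ 2 + q1 ^+ 2 by rewrite addr_gt0 ?exprn_gt0.
have n2 : 0 < p2 ^+ 2 + q2 ^+ 2 by rewrite addr_gt0 ?exprn_gt0.
exists ((q1 ^+ 2 - p1 ^+ 2) / (p1 ^+ 2 + q1 ^+ 2)),
  (2 * p1 * q1 / (p1 ^+ 2 + q1 ^+ 2)),
  ((q2 ^+ 2 - p2 ^+ 2) / (p2 ^+ 2 + q2 ^+ 2)),
  (2 * p2 * q2 / (p2 ^+ 2 + q2 ^+ 2)).
have [n1' n2' g' d'] : [/\ p1 ^+ 2 + q1 ^+ 2 != 0, p2 ^+ 2 + q2 ^+ 2 != 0,
    g != 0 & d != 0] by rewrite !gt_eqF.
split; [split; first exact: rational_angle| split; first exact: rational_angle | | ].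
- by rewrite divr_ge0 ?mulr_ge0// ltW.
- by rewrite divr_ge0 ?mulr_ge0// ltW.
- split.
    apply: divr_ge0; last exact: ltW.
    by rewrite subr_ge0 ler_pXn2r// nnegrE ltW.
  have -> : (q1 ^+ 2 - p1 ^+ 2) / (p1 ^+ 2 + q1 ^+ 2)
            + (q2 ^+ 2 - p2 ^+ 2) / (p2 ^+ 2 + q2 ^+ 2)
    = - (ordered_angles p1 q1 p2 q2 /
         ((p1 ^+ 2 + q1 ^+ 2) * (p2 ^+ 2 + q2 ^+ 2))).
    by rewrite /ordered_angles; field; rewrite n1' n2'.
  by rewrite oppr_le0 divr_ge0// ltW// mulr_gt0.
split.
- set X := (X in 0 < X).
  have -> : X = e * slack_apex (x ^+ 2) (y ^+ 2) (g * n) d p1 q1 /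
      (g * d * (p1 ^+ 2 + q1 ^+ 2)) ^+ 2.
    by rewrite /X /slack_apex; field; rewrite n1' g' d'.
  by rewrite divr_gt0// exprn_gt0// !mulr_gt0.
- set X := (X in 0 < X).
  have -> : X = e * slack_side (x ^+ 2) (y ^+ 2) (g * n) d p1 q1 p2 q2 /
      (g * d * (p1 ^+ 2 + q1 ^+ 2) * (p2 ^+ 2 + q2 ^+ 2)) ^+ 2.
    by rewrite /X /slack_side; field; rewrite n1' n2' g' d'.
  by rewrite divr_gt0// exprn_gt0// !mulr_gt0.
- set X := (X in 0 < X).
  have -> : X = e * slack_base (y ^+ 2) (g * n) d p2 q2 /
      (g * d * (p2 ^+ 2 + q2 ^+ 2)) ^+ 2.
    by rewrite /X /slack_base; field; rewrite n2' g' d'.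
  by rewrite divr_gt0// exprn_gt0// !mulr_gt0.
Qed.

Lemma zr_ratio_bounds (R : realType) (x g : Z) :
  [&& 0 < g, g < x & x ^+ 2 < 2%:R * g ^+ 2] ->
  1 < zr x / zr g :> R /\ (zr x / zr g) ^+ 2 < 2 :> R.
Proof.
move=> /and3P[/(zr_gt0 R) g0 /(zr_lt R) gx /(zr_lt R)].
rewrite zrX [zr (_ * _)]zrM zrX zr_natr => x2.
split; first by rewrite ltr_pdivlMr ?mul1r.
by rewrite expr_div_n ltr_pdivrMr ?exprn_gt0.
Qed.

Lemma sigma_lt_certificate (R : realType) (a x0 : R) (x y g n d p1 q1 p2 q2 : Z) :
  star_certificate 1 x y g n d p1 q1 p2 q2 ->
  [&& 0 < g, 0 < d, 0 < n & n < 2%:R * d] ->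
  1 <= a ^+ 2 <= 2 ->
  axis_form a x0 ((zr x / zr g) ^+ 2) ((zr y / zr g) ^+ 2) ->
  sigma a x0 < zr n / zr d.
Proof.
move=> cert /and4P[g0 d0 n0 nd] ha form.
have [c1 [s1 [c2 [s2 [[? ?] [? ?] [? ?] []]]]]] := star_certificate_sides R cert g0 d0.
rewrite (rmorph1 zr) !mul1r !subr_gt0 => ? ? ?.
apply: (sigma_lt_star (c1 := c1) (s1 := s1) (c2 := c2) (s2 := s2) ha _ form) => //.
have d0' := zr_gt0 R d0; rewrite divr_gt0 ?(zr_gt0 R n0)//= ltr_pdivrMr//.
by have := zr_lt R nd; rewrite zrM zr_natr.
Qed.

Lemma lt_sigma_certificate (R : realType) (a x0 : R) (x y g n d p1 q1 p2 q2 : Z) :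
  star_certificate (-1) x y g n d p1 q1 p2 q2 ->
  [&& 0 < g, 0 < d, 0 < n & n < 2%:R * d] ->
  1 <= a ^+ 2 <= 2 ->
  axis_form a x0 ((zr x / zr g) ^+ 2) ((zr y / zr g) ^+ 2) ->
  zr n / zr d < sigma a x0.
Proof.
move=> cert /and4P[g0 d0 n0 nd] ha form.
have [c1 [s1 [c2 [s2 [[? ?] [? ?] [? ?] []]]]]] := star_certificate_sides R cert g0 d0.
rewrite (rmorphN1 zr) !mulN1r !opprB !subr_gt0 => ? ? ?.
apply: (lt_sigma_star (c1 := c1) (s1 := s1) (c2 := c2) (s2 := s2) ha _ form) => //.
have d0' := zr_gt0 R d0; rewrite divr_gt0 ?(zr_gt0 R n0)//= ltr_pdivrMr//.
by have := zr_lt R nd; rewrite zrM zr_natr.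
Qed.

(** * Ratios of the axes for which the symmetric stars have equal sides *)
Definition axis_gap {R : realType} (a : R) : R := sigma a 0 - sigma a (pi / 2).

(** The half-angle tangents [p1 / q1] and [p2 / q2] of the angles [u] and [v] of
    [symmetric_star_angles]. *)
Variant half_tangents := HalfTangents (p1 q1 p2 q2 : Z).

(** The axes are in the ratio [a = x / g].  On the long axis the weights are
    [a ^+ 2] and [1 = (g / g) ^+ 2]; on the short axis they are exchanged, and the
    comparison with [n / d] goes the other way. *)
Definition axis_certificates (e x g n d : Z) (s t : half_tangents) : bool :=
  let: HalfTangents p1 q1 p2 q2 := s in let: HalfTangents p1' q1' p2' q2' := t in
  [&& star_certificate e x g g n d p1 q1 p2 q2,
      star_certificate (- e) g x g n d p1' q1' p2' q2',
      [&& 0 < g, g < x & x ^+ 2 < 2%:R * g ^+ 2]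
    & [&& 0 < g, 0 < d, 0 < n & n < 2%:R * d]].

Lemma axis_gap_lt0 (R : realType) (x g n d : Z) (s t : half_tangents) :
  axis_certificates 1 x g n d s t -> axis_gap (zr x / zr g) < 0 :> R.
Proof.
case: s t => [p1 q1 p2 q2] [p1' q1' p2' q2'] /and4P[cA cB xg nd].
have [a1 a2] := zr_ratio_bounds R xg.
have g0 : zr g != 0 :> R by case/and3P: xg => /(zr_gt0 R) /lt0r_neq0.
have ha : 1 <= (zr x / zr g : R) ^+ 2 <= 2 by rewrite exprn_ege1 ?(ltW a2)// ltW.
rewrite subr_lt0; apply: lt_trans.
  apply: (sigma_lt_certificate cA nd ha).
  by rewrite divff// expr1n; exact: axis_form0.
apply: (lt_sigma_certificate cB nd ha).
by rewrite divff// expr1n; exact: axis_form_pihalf.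
Qed.

Lemma axis_gap_gt0 (R : realType) (x g n d : Z) (s t : half_tangents) :
  axis_certificates (-1) x g n d s t -> 0 < axis_gap (zr x / zr g) :> R.
Proof.
case: s t => [p1 q1 p2 q2] [p1' q1' p2' q2'] /and4P[cA cB xg nd].
have [a1 a2] := zr_ratio_bounds R xg.
have g0 : zr g != 0 :> R by case/and3P: xg => /(zr_gt0 R) /lt0r_neq0.
have ha : 1 <= (zr x / zr g : R) ^+ 2 <= 2 by rewrite exprn_ege1 ?(ltW a2)// ltW.
rewrite subr_gt0; apply: lt_trans.
  apply: (sigma_lt_certificate cB nd ha).
  by rewrite divff// expr1n; exact: axis_form_pihalf.
apply: (lt_sigma_certificate cA nd ha).
by rewrite divff// expr1n; exact: axis_form0.
Qed.

Lemma axis_gap_zero (R : realType) (al ar : R) :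
  1 < al -> al <= ar -> ar ^+ 2 < 2 -> axis_gap al * axis_gap ar < 0 ->
  exists2 a, al <= a <= ar & sigma a 0 = sigma a (pi / 2).
Proof.
move=> al1 alr ar2 gap.
have [||a] := @IVT R axis_gap al ar 0 alr.
- apply: continuous_in_subspaceT => a; rewrite inE /= in_itv /= => /andP[la ar'].
  have a1 : 1 < a by exact: lt_le_trans la.
  have a2 : a ^+ 2 < 2.
    have a0 : 0 <= a := ltW (lt_trans ltr01 a1).
    by apply: le_lt_trans ar2; rewrite ler_pXn2r ?nnegrE// (le_trans a0).
  have ha : 1 <= a ^+ 2 <= 2 by rewrite exprn_ege1 ?(ltW a2)// ltW.
  have Fsqr : t ^+ 2 @[t --> a] --> a ^+ 2.
    by rewrite expr2; apply: cvgM; exact: cvg_id.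
  have near_a : \forall t \near a, 1 <= t ^+ 2 <= 2.
    near=> t; apply/andP; split.
      by apply: exprn_ege1; apply/ltW; near: t; exact: lt_nbhsr.
    by apply/ltW; near: t; exact: (cvgr_lt _ Fsqr).
  by apply: cvgB; apply: (@sigma_cvg R R (nbhs a) _ id (fun=> _)) => //;
    exact: cvg_cst.
- move: (axis_gap al) (axis_gap ar) gap => u v uv.
  have [u0|u0] := leP u 0; rewrite ge_min le_max.
    by rewrite u0 /=; apply/orP; right; rewrite leNgt; apply/negP => v0; nra.
  by rewrite (ltW u0) andbT; apply/orP; right; rewrite leNgt; apply/negP => v0; nra.
- by rewrite in_itv /= => ha /subr0_eq; exists a.
Unshelve. all: by end_near. Qed.

(** The numbers come from a numerical solution for the two symmetric stars, the
   half-angle tangents being rounded to fractions that keep the three sides on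
   the right side of [n / d]. *)
Lemma first_left_certificate :
  axis_certificates 1 26597 20000 1999508313 1000000000
    (HalfTangents 7405 5287 5173 5289) (HalfTangents 32477 1493 5605 12372).
Proof. by vm_compute. Qed.

Lemma first_right_certificate :
  axis_certificates (-1) 26599 20000 1999509799 1000000000
    (HalfTangents 9191 6563 4645 4749) (HalfTangents 114091 5240 2221 4903).
Proof. by vm_compute. Qed.

Lemma second_left_certificate :
  axis_certificates (-1) 28245 20000 199999857 100000000
    (HalfTangents 9929 7790 5857 5864) (HalfTangents 130805 2058 950 2289).
Proof. by vm_compute. Qed.

Lemma second_right_certificate :
  axis_certificates 1 28247 20000 199999863 100000000
    (HalfTangents 1277 1002 850 851) (HalfTangents 17641 277 947 2282).
Proof. by vm_compute. Qed.

Lemma axis_gap_zero_certified (R : realType) (e x y g n d n' d' : Z)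
    (s t s' t' : half_tangents) :
  (e == 1) || (e == -1) -> x <= y ->
  axis_certificates e x g n d s t -> axis_certificates (- e) y g n' d' s' t' ->
  exists a : R, [/\ zr x / zr g <= a <= zr y / zr g, 1 < a, a ^+ 2 < 2
                   & sigma a 0 = sigma a (pi / 2)].
Proof.
move=> e1 xy cx cy.
have bounds z m k u v f : axis_certificates f z g m k u v ->
    1 < zr z / zr g :> R /\ (zr z / zr g) ^+ 2 < 2 :> R /\ 0 < zr g :> R.
  case: u v => [p1 q1 p2 q2] [p1' q1' p2' q2'] /and4P[_ _ zg _].
  have [b1 b2] := zr_ratio_bounds R zg.
  by case/and3P: zg => /(zr_gt0 R).
have [x1 [_ g0]] := bounds _ _ _ _ _ _ cx.
have [_ [y2 _]] := bounds _ _ _ _ _ _ cy.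
have gap : axis_gap (zr x / zr g : R) * axis_gap (zr y / zr g) < 0.
  case/orP: e1 => /eqP eE; rewrite eE in cx cy.
    by rewrite nmulr_rlt0 ?(axis_gap_lt0 R cx)// (axis_gap_gt0 R cy).
  by rewrite pmulr_rlt0 ?(axis_gap_gt0 R cx)// (axis_gap_lt0 R cy).
have [|a /andP[xa ay] aE] := axis_gap_zero x1 _ y2 gap.
  by rewrite ler_pM2r ?invr_gt0// zr_le.
have a1 := lt_le_trans x1 xa; have a0 := ltW (lt_trans ltr01 a1).
exists a; split => //; first by rewrite xa.
by apply: le_lt_trans y2; rewrite ler_pXn2r ?nnegrE// (le_trans a0).
Qed.

(** * Conclusion *)
Lemma zr_ratioD (R : realFieldType) (e p q s n d : Z) :
  [&& 0 < q, 0 < s, 0 < d & (p * s + e * q) * d == n * (q * s)] ->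
  zr p / zr q + zr e * (1 / zr s) = zr n / zr d :> R.
Proof.
move=> /and4P[/(zr_gt0 R) q0 /(zr_gt0 R) s0 /(zr_gt0 R) d0 /eqP E].
have [hq hs hd] : [/\ zr q != 0 :> R, zr s != 0 :> R & zr d != 0 :> R].
  by rewrite !gt_eqF.
have {}E : (zr p * zr s + zr e * zr q) * zr d = zr n * (zr q * zr s) :> R.
  by have := congr1 (@zr R) E; rewrite !zrM zrD !zrM.
apply: (mulIf hd); rewrite divfK//; apply: (mulIf (mulf_neq0 hq hs)).
by rewrite -E; field; rewrite hq hs.
Qed.

Lemma center_distance (R : realFieldType) (m k n : nat) (p q s l u : Z) (a : R) :
  [&& p == Z.of_nat m, q == Z.of_nat k & s == Z.of_nat n] ->
  [&& 0 < q, 0 < s & (p * s + -1 * q) * s == l * (q * s)] ->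
  [&& 0 < q, 0 < s & (p * s + 1 * q) * s == u * (q * s)] ->
  zr l / zr s <= a <= zr u / zr s -> `|a - m%:R / k%:R| <= 1 / n%:R.
Proof.
move=> /and3P[/eqP pE /eqP qE /eqP sE].
move=> /and3P[q0 s0 lE] /and3P[_ _ uE] alu.
rewrite (zr_nat R pE) (zr_nat R qE) (zr_nat R sE) ler_distl.
have := @zr_ratioD R (-1) p q s l s; have := @zr_ratioD R 1 p q s u s.
rewrite q0 s0 lE uE (rmorph1 zr) (rmorphN1 zr) mul1r mulN1r.
by move=> /(_ isT) -> /(_ isT) ->.
Qed.

Theorem theorem1p2 (R : realType) :
  exists a1 a2 : R,
    [/\ a1 <> a2,
        `|a1 - 13299 / 10000| <= 1 / 20000,
        `|a2 - 14123 / 10000| <= 1 / 20000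
      & forall a : R, a = a1 \/ a = a2 ->
          [/\ 1 < a < Num.sqrt 2,
              `I_20 #<= local_minima circle (side_length a)
            & `I_20 #<= local_maxima circle (side_length a)]].
Proof.
have [||a1 [h1 a11 a12 a1E]] := axis_gap_zero_certified R _ _
  first_left_certificate first_right_certificate; [by []|by []|].
have [||a2 [h2 a21 a22 a2E]] := axis_gap_zero_certified R _ _
  second_left_certificate second_right_certificate; [by []|by []|].
have conclusion (a : R) : 1 < a -> a ^+ 2 < 2 -> sigma a 0 = sigma a (pi / 2) ->
    [/\ 1 < a < Num.sqrt 2, `I_20 #<= local_minima circle (side_length a)
      & `I_20 #<= local_maxima circle (side_length a)].
  move=> l1 l2 aE; have [cmin cmax] := side_length_extrema l1 l2 aE.
  split => //; rewrite l1 -(ger0_norm (ltW (lt_trans ltr01 l1))) -sqrtr_sqr.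
  by rewrite ltr_sqrt.
exists a1, a2; split; last by move=> a [->|->]; exact: conclusion.
- suff : a1 < a2 by move=> lt12 eq12; rewrite eq12 ltxx in lt12.
  case/andP: h1 => _ /le_lt_trans; apply; case/andP: h2 => + _; apply: lt_le_trans.
  by rewrite ltr_pM2r ?invr_gt0 ?zr_gt0// zr_lt.
- by apply: (@center_distance R 13299 10000 20000 13299 10000 20000 26597 26599)
    h1; vm_compute.
- by apply: (@center_distance R 14123 10000 20000 14123 10000 20000 28245 28247)
    h2; vm_compute.
Qed.
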